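(* Let $V^*=(A^*,\pi^* )\in S^{(m_1,r)}_{\mathbb R}(\mathcal F,u,h)$, $m_1=m_1(\mathcal F,u,h)$, be a critical point of $f_d$ on $S^{(m_1,r)}_{\mathbb R}(\mathcal F,u,h)$ with Lagrange multipliers $\mu^*\in\mathbb R^n$, and let $\mathcal L(W)=f_d(W)-\sum_{i=1}^n\mu^*_i\bigl(t(\mathcal F_i,W,h_i)-u_i\bigr)$. For every $\eta=(\eta_1,\dots,\eta_r)$ with each $\eta_k\in L^2([0,1]^2)$ symmetric, decomposed as $\eta=\bar\eta+\eta^\perp$ relative to the partition of $V^*$, $$D^2\mathcal L(V^* )[\eta,\eta]=D^2\mathcal L(V^* )[\bar\eta,\bar\eta]+D^2\mathcal L(V^* )[\eta^\perp,\eta^\perp],$$ i.e. the cross term $D^2\mathcal L(V^* )[\bar\eta,\eta^\perp]$ vanishes identically.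
   Context: Fix $r\ge1$. A multi-relational graph $F=(V(F),E_1(F),\dots,E_r(F))$ is a finite vertex set with $r$ sets of undirected edges, each edge listed once as a pair $(a,b)$. For $r$-tuples $W=(W_1,\dots,W_r)$ of symmetric measurable functions $[0,1]^2\to\mathbb R$ and $g=(g_1,\dots,g_r)$ real analytic functions $\mathbb R\to\mathbb R$, $$t(F,W,g)=\int_{[0,1]^{|V(F)|}}\prod_{k=1}^r\prod_{(a,b)\in E_k(F)}g_k(W_k(x_a,x_b))\prod_{v\in V(F)}dx_v .$$ A quantum graph is a finite real linear combination of multi-relational graphs; $t$ is extended linearly. $\mathcal F=(\mathcal F_1,\dots,\mathcal F_n)$ is an ordered set of quantum graphs, $h$ an $n\times r$ matrix of real analytic functions with rows $h_i$, $t(\mathcal F,W,h)=(t(\mathcal F_i,W,h_i))_{i=1}^n$, $u\in\mathbb R^n$. $f_0:\mathbb R\to\mathbb R$ is analytic and $f_d(W)=\sum_{k=1}^r\int_{[0,1]^2}f_0(W_k(x,y))\,dx\,dy$. Step functions. For $m\ge1$, an $r$-tuple $A=(A_{ij;k})$ of real symmetric $m\times m$ matrices and $\pi\in[0,1]^m$ with $\sum_i\pi_i=1$, let $S_1,\dots,S_m$ be consecutive intervals of lengths $\pi_i$ partitioning $[0,1]$; the step function $(A,\pi)$ equals $A_{ij;k}$ on $S_i\times S_j$ in coordinate $k$. $\mathcal W^{(m,r)}_{\mathbb R}$ is the space of all such $(A,\pi)$, $\mathcal W^{(m,r)}$ the subset with all $A_{ij;k}\in[0,1]$, $S^{(m,r)}_{\mathbb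 R}(\mathcal F,u,h)=\{(A,\pi)\in\mathcal W^{(m,r)}_{\mathbb R}:t(\mathcal F,(A,\pi),h)=u\}$, and $m_1(\mathcal F,u,h)=\min\{m: r\frac{m(m+1)}2>n+1,\ u\in \operatorname{int}t(\mathcal F,\mathcal W^{(m,r)},h)\}$. Critical point with multipliers $\mu^*$ means: the derivative of $(A,\pi)\mapsto\mathcal L((A,\pi))$ at $(A^*,\pi^* )$ vanishes along all $(\delta A,\delta\pi)$ with $\sum_i\delta\pi_i=0$. Decomposition. Let $S_1,\dots,S_{m_1}$ be the partition of $V^*$, $|S_i|=\pi^*_i>0$. For symmetric $\eta_k\in L^2([0,1]^2)$, $\bar\eta_k=\sum_{i,j}\Bigl(\frac1{\pi^*_i\pi^*_j}\int_{S_i\times S_j}\eta_k\Bigr)\mathbb 1_{S_i\times S_j}$ and $\eta^\perp_k=\eta_k-\bar\eta_k$. Second variation. For bounded symmetric $\eta$, $D^2\mathcal L(V^* )[\eta,\eta]=\frac{d^2}{d\varepsilon^2}\big|_{\varepsilon=0}\mathcal L(V^*+\varepsilon\eta)$; this quadratic form is bounded in the $L^2$ norm and is extended by continuity to all symmetric $L^2$ tuples, with $D^2\mathcal L(V^* )[\cdot,\cdot]$ the associated symmetric bilinear form. *)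

(* Defs.v *)
From HB Require Import structures.
From mathcomp Require Import all_boot all_order all_algebra.
From mathcomp Require Import all_classical all_reals all_analysis.

Set Implicit Arguments.
Unset Strict Implicit.
Unset Printing Implicit Defensive.

Import Order.TTheory GRing.Theory Num.Theory.
Import numFieldNormedType.Exports.

Local Open Scope classical_set_scope.
Local Open Scope ring_scope.

(* Functions on [0,1]^2 are represented by functions on R * R; only their
   values on the unit square matter, because every integral is taken against a
   measure concentrated there. *)

Section unit_cube.
Variable R : realType.

Definition leb01 : set (measurableTypeR R) -> \bar R :=
  mrestr (@lebesgue_measure R) (measurable_itv `[0%R, 1%R]).

HB.instance Definition _ := Measure.on leb01.

Fact leb01_setT : leb01 setT = 1%E.
Proof.
rewrite /leb01 /mrestr setTI lebesgue_measure_itv /= lte_fin ltr01.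
by rewrite oppr0 adde0.
Qed.

HB.instance Definition _ := Measure_isProbability.Build _ _ _ leb01 leb01_setT.

Definition leb01sq := (leb01 \x leb01)%E.
HB.instance Definition _ := Probability.on leb01sq.

Definition tuple_cons q (z : measurableTypeR R * q.-tuple (measurableTypeR R)) :
  q.+1.-tuple (measurableTypeR R) := [tuple of z.1 :: z.2].

Fact measurable_tuple_cons q : measurable_fun setT (@tuple_cons q).
Proof. exact: measurable_cons. Qed.

HB.instance Definition _ q := isMeasurableFun.Build _ _ _ _ (@tuple_cons q)
  (@measurable_tuple_cons q).

(* Lebesgue measure on [0,1]^q: [0,1]^(q+1) carries the image of the product
   measure on [0,1] x [0,1]^q under (x, t) |-> x :: t. *)
Fixpoint leb01_cube q : probability (q.-tuple (measurableTypeR R)) R :=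
  if q is q'.+1 then distribution (leb01 \x leb01_cube q')%E (@tuple_cons q')
  else \d_([tuple]).

End unit_cube.
Arguments leb01 R : clear implicits.
Arguments leb01sq R : clear implicits.

Definition real_analytic (R : realType) (g : R -> R) : Prop :=
  forall x0 : R, exists a : nat -> R, exists2 rho : R, 0 < rho &
    forall y : R, `|y - x0| < rho -> pseries a (y - x0) @ \oo --> g y.

(* edges_once says that an undirected edge is listed in one orientation only;
   with a = b it also excludes loops. *)
Record mgraph (r : nat) := MGraph {
  nverts : nat;
  edges : 'I_r -> {set 'I_nverts * 'I_nverts};
  edges_once : forall k a b, (a, b) \in edges k -> (b, a) \notin edges k
}.

Section densities.
Variables (R : realType) (r : nat).

Definition kernels := 'I_r -> R * R -> R.

Definition qgraph := seq (R * mgraph r).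

Definition graph_density (F : mgraph r) (W : kernels) (g : 'I_r -> R -> R) : R :=
  \int[leb01_cube R (nverts F)]_x
    \prod_(k < r) \prod_(e in edges F k) g k (W k (tnth x e.1, tnth x e.2)).

Definition density (Q : qgraph) (W : kernels) (g : 'I_r -> R -> R) : R :=
  \sum_(cF <- Q) cF.1 * graph_density cF.2 W g.

Definition densities n (Fs : 'I_n -> qgraph) (W : kernels)
    (h : 'I_n -> 'I_r -> R -> R) : 'rV[R]_n :=
  \row_(i < n) density (Fs i) W (h i).

Definition f_d (f0 : R -> R) (W : kernels) : R :=
  \sum_(k < r) \int[leb01sq R]_z f0 (W k z).

Definition lagrangian n (f0 : R -> R) (Fs : 'I_n -> qgraph) (u : 'rV[R]_n)
    (h : 'I_n -> 'I_r -> R -> R) (mu : 'rV[R]_n) (W : kernels) : R :=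
  f_d f0 W - \sum_(i < n) mu 0 i * (density (Fs i) W (h i) - u 0 i).

End densities.

Section step_functions.
Variables (R : realType) (r m : nat).
Implicit Types (A : 'I_r -> 'M[R]_m) (pi : 'I_m -> R).

Definition cumul pi (j : nat) : R := \sum_(l < m | (l < j)%N) pi l.

(* The last interval is closed on the right, the others are half-open
   ([BSide true] on the right is the open bound). *)
Definition cell pi (i : 'I_m) : set R :=
  [set` Interval (BLeft (cumul pi i)) (BSide (i.+1 < m)%N (cumul pi i.+1))].

Definition step A pi : kernels R r := fun k z =>
  \sum_(i < m) \sum_(j < m) A k i j * \1_(cell pi i `*` cell pi j) z.

Definition step_space A pi : Prop :=
  [/\ forall k, (A k)^T = A k, forall i, 0 <= pi i <= 1 &
      \sum_(i < m) pi i = 1].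

Definition step_space01 A pi : Prop :=
  step_space A pi /\ forall k i j, 0 <= A k i j <= 1.

Definition step_constraint n (Fs : 'I_n -> qgraph R r) (u : 'rV[R]_n)
    (h : 'I_n -> 'I_r -> R -> R) A pi : Prop :=
  step_space A pi /\ densities Fs (step A pi) h = u.

Definition step_critical (L : kernels R r -> R) A pi : Prop :=
  forall (dA : 'I_r -> 'M[R]_m) (dpi : 'I_m -> R),
    (forall k, (dA k)^T = dA k) -> \sum_(i < m) dpi i = 0 ->
    is_derive (0 : R) (1 : R)
      (fun e : R => L (step (fun k => A k + e *: dA k)
                            (fun i => pi i + e * dpi i))) 0.

Definition block_avg pi (eta : kernels R r) : kernels R r := fun k z =>
  \sum_(i < m) \sum_(j < m)
    (pi i * pi j)^-1 * (\int[leb01sq R]_(w in cell pi i `*` cell pi j) eta k w)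
    * \1_(cell pi i `*` cell pi j) z.

Definition block_perp pi (eta : kernels R r) : kernels R r := fun k z =>
  eta k z - block_avg pi eta k z.

End step_functions.

Definition m1_admissible (R : realType) (r n : nat) (Fs : 'I_n -> qgraph R r)
    (u : 'rV[R]_n) (h : 'I_n -> 'I_r -> R -> R) (m : nat) : Prop :=
  (n + 1 < r * (m * (m + 1) %/ 2))%N /\
  ([set densities Fs (step Ap.1 Ap.2) h | Ap in
      [set Ap : ('I_r -> 'M[R]_m) * ('I_m -> R) | step_space01 Ap.1 Ap.2]])° u.

Definition is_m1 (R : realType) (r n : nat) (Fs : 'I_n -> qgraph R r)
    (u : 'rV[R]_n) (h : 'I_n -> 'I_r -> R -> R) (m : nat) : Prop :=
  m1_admissible Fs u h m /\
  forall m', m1_admissible Fs u h m' -> (m <= m')%N.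

Section second_variation.
Variables (R : realType) (r : nat).
Implicit Types (L : kernels R r -> R) (V eta zeta : kernels R r).

Definition symmetric_ae (f : R * R -> R) : Prop :=
  {ae leb01sq R, forall z, f z = f (z.2, z.1)}.

Definition sym_L2 eta : Prop :=
  forall k, eta k \in Lfun (leb01sq R) 2%:E /\ symmetric_ae (eta k).

Definition sym_bounded zeta : Prop :=
  (forall k, measurable_fun setT (zeta k) /\ symmetric_ae (zeta k)) /\
  exists M : R, forall k z, `|zeta k z| <= M.

Definition second_var_bounded L V zeta : R :=
  derive1n 2 (fun e : R => L (fun k z => V k z + e * zeta k z)) 0.

Definition L2_approx eta : set_system (kernels R r) :=
  filter_from [set d : R | 0 < d] (fun d => [set zeta | sym_bounded zeta /\
    forall k, ('N[leb01sq R]_2%:E [EFin \o (zeta k \- eta k)%R] < d%:E)%E]).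

(* Extension by continuity of the second variation from the dense subspace of
   bounded symmetric tuples to symmetric L^2 tuples. *)
Definition second_var L V eta : R :=
  lim (second_var_bounded L V @ L2_approx eta).

Definition second_var_bil L V eta zeta : R :=
  (second_var L V (fun k z => eta k z + zeta k z)
   - second_var L V eta - second_var L V zeta) / 2.

End second_variation.

(* Main.v *)
Require Import Defs.
From mathcomp Require Import all_boot all_order all_algebra.
From mathcomp Require Import ring.
From mathcomp Require Import all_classical all_reals all_analysis.
From mathcomp Require Import measurable_realfun.

(** Let [V] be the step function and let [eta] be a symmetric square integrable
    tuple, with block average [abar] and complement [p = eta - abar]. The theorem
    holds because the second variation at [V] is a bounded bilinear form [B] all of
    whose coefficients are constant on boxes of cells of [V].

    Up to a constant the Lagrangian is a linear combination of graph densities: the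
    objective [f_d] is itself a sum of densities of graphs with one edge
    ([integral_edge_graph]). Differentiating a graph density twice along a line
    gives a sum, over ordered pairs of edges [(i, l)], of integrals over the cube of
    a coefficient times the direction read at [i] times the direction read at [l];
    the coefficient is a product over the edges of analytic functions of [V], with
    the factors of [i] and [l] differentiated ([is_derive_line_integral],
    [graph_form_derive]).

    In a cross term one of the two directions is [abar] and the other one is [p],
    read at an edge [(a, b)]. The coefficient and [abar] depend only on the cells
    that contain the coordinates. So on each box of cells the integral is a
    constant times the integral of [p] over the product of the cells of the
    coordinates [a] and [b], and that is zero by definition of the block average
    ([integral_block_constant_eq0], [edge_form_cross]). It matters that [a] and [b]
    are distinct.

    The second variation is defined by its values on bounded symmetric tuples and
    a limit in quadratic mean. By Cauchy-Schwarz [B] is bounded for the [L2] norms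
    ([edge_form_bound]), bounded symmetric tuples are dense by truncation
    ([L2_approx_proper]), and therefore the limit exists and equals [B eta eta] for
    each square integrable symmetric tuple ([second_varE]). This applies to [abar]
    and [p] as well, because block averages of a symmetric tuple are symmetric.
    Expanding [B (abar + p) (abar + p)] then gives the decomposition, and the
    bilinear form obtained by polarization vanishes on [abar] and [p]. *)

Set Implicit Arguments.
Unset Strict Implicit.
Unset Printing Implicit Defensive.

Import Order.TTheory GRing.Theory Num.Theory.
Import numFieldNormedType.Exports.

Local Open Scope classical_set_scope.
Local Open Scope ring_scope.

(** * Derivatives of real analytic functions *)

Section analytic.
Variable R : realType.
Implicit Types (a : nat -> R) (g : R -> R).

(** The sum times [(1 - q) ^+ 2] telescopes; a bound independent of [n] is all
    that the comparison test below asks for. *)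
Lemma arith_geom_sum_le (q : R) n : 0 <= q < 1 ->
  \sum_(0 <= i < n) i.+1%:R * q ^+ i <= ((1 - q) ^+ 2)^-1.
Proof.
move=> /andP[q0 q1]; have q2 : 0 < (1 - q) ^+ 2 by rewrite exprn_gt0// subr_gt0.
rewrite -[leRHS]mul1r ler_pdivlMr//.
suff -> : (\sum_(0 <= i < n) i.+1%:R * q ^+ i) * (1 - q) ^+ 2 =
    1 - q ^+ n * (1 + n%:R * (1 - q)).
  by rewrite gerBl mulr_ge0 ?exprn_ge0// addr_ge0// mulr_ge0// subr_ge0 ltW.
elim: n => [|n IH]; first by rewrite big_geq// expr0 mul0r mul0r addr0 mul1r subrr.
rewrite big_nat_recr//= mulrDl IH -natr1 [q ^+ n.+1]exprS; ring.
Qed.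

(** The terms [a n * y ^+ n] are bounded, so with [q = `|x| / `|y|] the
    differentiated series at [x] is dominated by a multiple of
    [(n + 1) * q ^+ n]. *)
Lemma is_cvg_pseries_diffs a (x y : R) : cvgn (pseries a y) -> `|x| < `|y| ->
  cvgn (pseries (pseries_diffs a) x).
Proof.
move=> ay xy.
have y0 : 0 < `|y| by rewrite (le_lt_trans _ xy).
have [M [_ aM]] := cvg_series_bounded ay.
have {aM}aM n : `|a n| * `|y| ^+ n <= M + 1.
  by rewrite -normrX -normrM; apply: aM => //; rewrite ltrDl.
have M0 : 0 <= M + 1 by rewrite (le_trans _ (aM 0%N))// mulr_ge0.
pose q := `|x| / `|y|.
have q0 : 0 <= q by rewrite divr_ge0.
have q1 : q < 1 by rewrite ltr_pdivrMr ?mul1r.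
have Cq : cvgn (series (fun n => n.+1%:R * q ^+ n)).
  apply: nondecreasing_is_cvgn.
    by apply: nondecreasing_series => n _ _; rewrite mulr_ge0// exprn_ge0.
  exists ((1 - q) ^+ 2)^-1 => _ [n _ <-].
  by apply: arith_geom_sum_le; rewrite q0.
apply: normed_cvg.
apply: (@series_le_cvg _ _
  (((M + 1) / `|y|) *: (fun n => n.+1%:R * q ^+ n))) => [n|n|n|] //=.
- by rewrite mulr_ge0 ?divr_ge0// mulr_ge0// exprn_ge0.
- rewrite /pseries_diffs !normrM normr_nat normrX.
  rewrite [leRHS](_ : _ = n.+1%:R * ((M + 1) / `|y|) * q ^+ n); last first.
    by rewrite [LHS]mulrCA mulrA.
  rewrite -mulrA -[leRHS]mulrA ler_wpM2l//.
  rewrite expr_div_n mulrACA -invfM -exprS mulrC (mulrC (M + 1)) -mulrA.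
  by rewrite ler_wpM2l ?exprn_ge0// ler_pdivlMr ?exprn_gt0.
- exact: is_cvg_seriesZ.
Qed.

(** Term by term differentiation is valid on the whole open disc of
    convergence, since each point [y - x0] lies strictly inside a smaller disc
    on which the series and its first two formal derivatives converge. *)
Lemma real_analytic_is_derive g x0 a (rho : R) :
  (forall y, `|y - x0| < rho -> pseries a (y - x0) @ \oo --> g y) ->
  forall y, `|y - x0| < rho ->
    is_derive y 1 g (limn (pseries (pseries_diffs a) (y - x0))) /\
    cvgn (pseries (pseries_diffs a) (y - x0)).
Proof.
move=> ga y yrho.
have ca t : `|t| < rho -> cvgn (pseries a t).
  by move=> tr; have := ga (x0 + t); rewrite addrAC subrr add0r => /(_ tr)/cvgP.
have [K /andP[yK Kr]] : exists K, `|y - x0| < K < rho.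
  by exists ((`|y - x0| + rho) / 2); rewrite !(midf_lt yrho).
have K0 : 0 < K by rewrite (le_lt_trans _ yK).
have cd b : (forall t, `|t| < rho -> cvgn (pseries b t)) ->
    forall t, `|t| < rho -> cvgn (pseries (pseries_diffs b) t).
  move=> bc t tr.
  have m0 : 0 <= (`|t| + rho) / 2.
    by rewrite divr_ge0// addr_ge0// (le_trans _ (ltW tr)).
  apply: (@is_cvg_pseries_diffs _ _ ((`|t| + rho) / 2)).
    by apply: bc; rewrite (ger0_norm m0) (midf_lt tr).
  by rewrite (ger0_norm m0) (midf_lt tr).
have nK : `|K| = K by rewrite gtr0_norm.
split; last exact: cd.
pose f t := limn (pseries a t).
have df : is_derive (y - x0) (1 : R) f (limn (pseries (pseries_diffs a) (y - x0))).
  by apply: (@pseries_snd_diffs _ _ K); [apply: ca|apply: cd => //|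
    apply: (cd _ (cd _ ca))|]; rewrite nK.
have {df} dfc : is_derive y (1 : R) (f \o (fun t => t - x0))
    (limn (pseries (pseries_diffs a) (y - x0))).
  rewrite -[X in is_derive _ _ _ X]mulr1; apply: is_derive1_comp.
  have : is_derive y (1 : R) (id - cst x0) (1 - 0 : R) by apply: is_deriveB.
  by rewrite subr0.
apply: near_eq_is_derive dfc.
near=> t; rewrite /f /=; apply: cvg_lim => //; apply: ga.
near: t.
have : (`|t - x0| @[t --> y] --> `|y - x0|).
  by apply: cvg_norm; apply: cvgB; [exact: cvg_id|exact: cvg_cst].
by move/(cvgr_lt _) => /(_ _ yrho).
Unshelve. all: by end_near. Qed.

Lemma real_analytic_derivable g : real_analytic g -> forall x, derivable g x 1.
Proof.
move=> ga x; have [a [rho rho0 ha]] := ga x.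
have xx : `|x - x| < rho by rewrite subrr normr0.
by have [[]] := real_analytic_is_derive ha xx.
Qed.

(** The differentiated series represents the derivative on the same disc. *)
Lemma real_analytic_derive1 g : real_analytic g -> real_analytic (derive1 g).
Proof.
move=> ga x; have [a [rho rho0 ha]] := ga x.
exists (pseries_diffs a), rho => // y yr.
have [dg cg] := real_analytic_is_derive ha yr.
by rewrite derive1E (@derive_val _ _ _ _ _ _ _ dg).
Qed.

Lemma real_analytic_continuous g : real_analytic g -> continuous g.
Proof.
move=> ga x; apply: differentiable_continuous.
by apply/derivable1_diffP; exact: real_analytic_derivable.
Qed.

End analytic.

(** * Bounded measurable functions *)

Section bounded_on.
Variables (R : realType) (X : Type) (A : set X).
Implicit Types f g : X -> R.

(** The domain carries no structure, so that the notion also applies to a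
    parameter ranging over an interval paired with a point of a measurable
    space; this is how bounds uniform in the parameter are obtained. *)
Definition bounded_on f := exists M, forall x, A x -> `|f x| <= M.

Lemma bounded_on_cst (c : R) : bounded_on (fun=> c).
Proof. by exists `|c|. Qed.

Lemma bounded_onD f g :
  bounded_on f -> bounded_on g -> bounded_on (fun x => f x + g x).
Proof.
move=> [M fM] [N gN]; exists (M + N) => x Ax.
by rewrite (le_trans (ler_normD _ _))// lerD ?fM ?gN.
Qed.

Lemma bounded_onM f g :
  bounded_on f -> bounded_on g -> bounded_on (fun x => f x * g x).
Proof.
move=> [M fM] [N gN]; exists (M * N) => x Ax.
by rewrite normrM ler_pM ?fM ?gN.
Qed.

Lemma bounded_on_sum (I : Type) (s : seq I) (F : I -> X -> R) :
  (forall i, bounded_on (F i)) -> bounded_on (fun x => \sum_(i <- s) F i x).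
Proof.
move=> bF; elim: s => [|i s IH].
  by under eq_fun do rewrite big_nil; exact: bounded_on_cst.
by under eq_fun do rewrite big_cons; exact: bounded_onD.
Qed.

Lemma bounded_on_prod (I : Type) (s : seq I) (F : I -> X -> R) :
  (forall i, bounded_on (F i)) -> bounded_on (fun x => \prod_(i <- s) F i x).
Proof.
move=> bF; elim: s => [|i s IH].
  by under eq_fun do rewrite big_nil; exact: bounded_on_cst.
by under eq_fun do rewrite big_cons; exact: bounded_onM.
Qed.

Lemma bounded_on_comp (g : R -> R) f :
  continuous g -> bounded_on f -> bounded_on (fun x => g (f x)).
Proof.
move=> cg [M fM].
have /compact_bounded[N [_ gN]] : compact (g @` `[- M, M]).
  apply: continuous_compact; last exact: segment_compact.
  exact: continuous_subspaceT.
exists (N + 1) => x /fM; rewrite ler_norml => fx.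
by apply: gN; [rewrite ltrDl|exists (f x)].
Qed.

End bounded_on.

Section bounded_measurable.
Context (R : realType) d (T : measurableType d).
Implicit Types f g : T -> R.

Definition bounded_measurable f :=
  measurable_fun setT f /\ bounded_on setT f.

Lemma bounded_measurable_cst (c : R) : bounded_measurable (fun=> c).
Proof. by split; [exact: measurable_cst|exact: bounded_on_cst]. Qed.

Lemma bounded_measurableD f g : bounded_measurable f -> bounded_measurable g ->
  bounded_measurable (fun x => f x + g x).
Proof.
by move=> [mf bf] [mg bg]; split; [exact: measurable_funD|exact: bounded_onD].
Qed.

Lemma bounded_measurableM f g : bounded_measurable f -> bounded_measurable g ->
  bounded_measurable (fun x => f x * g x).
Proof.
by move=> [mf bf] [mg bg]; split; [exact: measurable_funM|exact: bounded_onM].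
Qed.

Lemma bounded_measurableZ c f : bounded_measurable f ->
  bounded_measurable (fun x => c * f x).
Proof. by apply: bounded_measurableM; exact: bounded_measurable_cst. Qed.

Lemma bounded_measurable_sum (I : Type) (s : seq I) (F : I -> T -> R) :
  (forall i, bounded_measurable (F i)) ->
  bounded_measurable (fun x => \sum_(i <- s) F i x).
Proof.
move=> bF; split; last by apply: bounded_on_sum => i; case: (bF i).
by apply: measurable_sum => i; case: (bF i).
Qed.

Lemma bounded_measurable_prod (I : eqType) (s : seq I) (F : I -> T -> R) :
  (forall i, bounded_measurable (F i)) ->
  bounded_measurable (fun x => \prod_(i <- s) F i x).
Proof.
move=> bF; split; last by apply: bounded_on_prod => i; case: (bF i).
by apply: measurable_prod => i _; case: (bF i).
Qed.

Lemma bounded_measurable_comp (g : R -> R) f :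
  continuous g -> bounded_measurable f -> bounded_measurable (fun x => g (f x)).
Proof.
move=> cg [mf bf]; split; last exact: bounded_on_comp.
by apply: measurableT_comp => //; exact: continuous_measurable_fun.
Qed.

Lemma bounded_measurable_bounded f : bounded_measurable f ->
  [bounded f x | x in (setT : set T)].
Proof.
move=> [_ [M fM]]; exists M; split; first exact: num_real.
by move=> x Mx y /= _; rewrite (le_trans (fM y I))// ltW.
Qed.

Lemma bounded_measurable_integrable (P : {finite_measure set T -> \bar R}) f :
  bounded_measurable f -> P.-integrable setT (EFin \o f).
Proof.
move=> bf; apply: measurable_bounded_integrable => //.
- by rewrite -ge0_fin_numE//; exact: fin_num_measure.
- by case: bf.
- exact: bounded_measurable_bounded.
Qed.

Lemma probability_nonempty (P : probability T R) : [set: T] !=set0.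
Proof.
apply/set0P/eqP => T0; have := probability_setT P.
by rewrite T0 measure0 => /eqP; rewrite eq_sym onee_eq0.
Qed.

Lemma measurable_abse_sqr f : measurable_fun setT f ->
  measurable_fun setT (fun x => (`|(EFin \o f) x| `^ 2)%E).
Proof.
move=> mf; apply/(@measurableT_comp _ _ _ _ _ _ (@poweR R ^~ 2)).
  exact: measurable_poweR.
by apply: measurableT_comp => //; exact/measurable_EFinP.
Qed.

Lemma Rintegral_sum (P : {measure set T -> \bar R}) (I : Type) (s : seq I)
    (F : I -> T -> R) :
  (forall i, P.-integrable setT (EFin \o F i)) ->
  \int[P]_x (\sum_(i <- s) F i x) = \sum_(i <- s) \int[P]_x F i x.
Proof.
move=> iF; rewrite /Rintegral.
under eq_integral do rewrite -sumEFin.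
rewrite integral_sum//.
rewrite -[RHS]/(fine _%:E) -sumEFin; congr fine; apply: eq_bigr => i _.
by rewrite fineK//; exact: (integrable_fin_num measurableT (iF i)).
Qed.

End bounded_measurable.

Lemma bounded_measurable_precomp (R : realType) d d' (T : measurableType d)
    (T' : measurableType d') (phi : T' -> T) (f : T -> R) :
  measurable_fun setT phi -> bounded_measurable f ->
  bounded_measurable (fun x => f (phi x)).
Proof.
move=> mphi [mf [M fM]]; split; first exact: measurableT_comp.
by exists M => x _; exact: fM.
Qed.

(** * Differentiation of products of analytic functions under the integral *)

(** Leibniz rule, each summand being written as a product over the same index
    sequence. Uniqueness of the indices makes the test [j == i] single out one
    factor only. *)
Lemma is_derive_prod (R : realType) (J : eqType) (s : seq J) (f df : J -> R -> R)
    (e : R) :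
  uniq s -> (forall j, is_derive e (1 : R) (f j) (df j e)) ->
  is_derive e (1 : R) (fun t => \prod_(j <- s) f j t)
    (\sum_(i <- s) \prod_(j <- s) (if j == i then df j e else f j e)).
Proof.
move=> + dfE; elim: s => [_|i s IH] /=.
  under eq_fun do rewrite big_nil.
  by rewrite big_nil; exact: is_derive_cst.
move=> /andP[si us]; under eq_fun do rewrite big_cons.
have := is_deriveM (dfE i) (IH us); rewrite /GRing.scale/= => h.
apply: is_derive_eq h _; rewrite big_cons addrC; congr (_ + _).
  rewrite big_cons eqxx mulrC; congr (_ * _).
  rewrite !big_seq; apply: eq_bigr => j js.
  by case: eqP => // ji; rewrite -ji js in si.
rewrite mulr_sumr !big_seq; apply: eq_bigr => j js; rewrite big_cons.
by case: eqP => // ij; rewrite ij js in si.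
Qed.

(** A family of functions of the same kind as [gs], so that the first derivative
    of a product integral is again a sum of product integrals and can be
    differentiated by the same lemma. *)
Definition derive_at (R : realType) (J : eqType) (gs : J -> R -> R) (i j : J) :
    R -> R :=
  if j == i then derive1 (gs j) else gs j.

Lemma real_analytic_derive_at (R : realType) (J : eqType) (gs : J -> R -> R) i :
  (forall j, real_analytic (gs j)) -> forall j, real_analytic (derive_at gs i j).
Proof.
by move=> ga j; rewrite /derive_at; case: ifP => // _; exact: real_analytic_derive1.
Qed.

Section line_integral.
Context (R : realType) d (T : measurableType d) (P : probability T R).
Variables (J : eqType) (s : seq J) (v w : J -> T -> R).
Hypothesis us : uniq s.
Hypothesis bv : forall j, bounded_measurable (v j).
Hypothesis bw : forall j, bounded_measurable (w j).

(** The weight [c] collects the factors [w i] that appear with each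
    differentiation in the direction [w]. *)
Definition line_integrand (gs : J -> R -> R) (c : T -> R) (e : R) (x : T) : R :=
  c x * \prod_(j <- s) gs j (v j x + e * w j x).

Definition line_integral gs c (e : R) : R := \int[P]_x line_integrand gs c e x.

Variable gs : J -> R -> R.
Hypothesis ga : forall j, real_analytic (gs j).
Variable c : T -> R.
Hypothesis bc : bounded_measurable c.

Lemma bounded_measurable_line_integrand e :
  bounded_measurable (line_integrand gs c e).
Proof.
apply: bounded_measurableM => //; apply: bounded_measurable_prod => j.
apply: bounded_measurable_comp; first exact: real_analytic_continuous.
by apply: bounded_measurableD => //; exact: bounded_measurableZ.
Qed.

Lemma is_derive_line_integrand x e :
  is_derive e (1 : R) (fun t => line_integrand gs c t x)
    (\sum_(i <- s) line_integrand (derive_at gs i) (fun x => c x * w i x) e x).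
Proof.
pose dg j t := derive1 (gs j) (v j x + t * w j x) * w j x.
have dgE j : is_derive e (1 : R) (fun t => gs j (v j x + t * w j x)) (dg j e).
  apply: is_derive1_comp.
  - have gd := @real_analytic_derivable _ _ (ga j) (v j x + e * w j x).
    by rewrite derive1E; apply: DeriveDef.
  - have : is_derive e (1 : R) (cst (v j x) + w j x *: id) (0 + w j x *: 1).
      exact: is_deriveD.
    rewrite add0r [X in is_derive _ _ _ X]mulr1; congr is_derive.
    by apply/funext => t /=; rewrite /cst [in RHS]mulrC.
have h := is_deriveM (is_derive_cst (c x) e 1) (is_derive_prod us dgE).
apply: is_derive_eq h _; rewrite scaler0 addr0 [LHS]mulr_sumr.
rewrite !big_seq; apply: eq_bigr => i si.
rewrite /line_integrand -mulrA; congr (_ * _).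
rewrite !(bigD1_seq i)//= eqxx /dg /derive_at eqxx mulrA [in RHS](mulrC (w i x)).
congr (_ * _).
by apply: eq_bigr => j /negPf ->.
Qed.

(** This provides the dominating constant for differentiation under the
    integral sign. *)
Lemma line_integrand_locally_bounded (K : R) :
  exists M, forall e x, `|e| <= K -> `|line_integrand gs c e x| <= M.
Proof.
have [M Mb] : bounded_on [set z : R * T | `|z.1| <= K]
    (fun z => line_integrand gs c z.1 z.2).
  have bT (f : T -> R) : bounded_measurable f ->
      bounded_on [set z : R * T | `|z.1| <= K] (fun z => f z.2).
    by move=> [_ [M fM]]; exists M => z _; exact: fM.
  apply: bounded_onM; first exact: bT.
  apply: bounded_on_prod => j.
  apply: bounded_on_comp; first exact: real_analytic_continuous.
  apply: bounded_onD; first exact: bT.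
  by apply: bounded_onM; [exists K|exact: bT].
by exists M => e x eK; exact: (Mb (e, x)).
Qed.

End line_integral.

Section line_integral_derive.
Context (R : realType) d (T : measurableType d) (P : probability T R).
Variables (J : eqType) (s : seq J) (v w : J -> T -> R).
Hypothesis us : uniq s.
Hypothesis bv : forall j, bounded_measurable (v j).
Hypothesis bw : forall j, bounded_measurable (w j).

(** The integrand is differentiable with a derivative bounded uniformly over
    the parameters at distance less than 1 from [e], and constants are
    integrable for a probability. *)
Lemma is_derive_line_integral (gs : J -> R -> R) (c : T -> R) (e : R) :
  (forall j, real_analytic (gs j)) -> bounded_measurable c ->
  is_derive e (1 : R) (line_integral P s v w gs c)
   (\sum_(i <- s) line_integral P s v w (derive_at gs i) (fun x => c x * w i x) e).
Proof.
move=> ga bc.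
pose df t x :=
  \sum_(i <- s) line_integrand s v w (derive_at gs i) (fun x => c x * w i x) t x.
have d1E t x : partial1of2 (line_integrand s v w gs c) t x = df t x.
  rewrite partial1of2E.
  by have hd := is_derive_line_integrand v w us ga c x t; rewrite derive_val.
have bcw i : bounded_measurable (fun x => c x * w i x) by exact: bounded_measurableM.
have [M dM] : exists M, forall t x, `|t| <= `|e| + 1 -> `|df t x| <= M.
  have /choice[M dM] i := line_integrand_locally_bounded s bv bw
    (real_analytic_derive_at i ga) (bcw i) (`|e| + 1).
  exists (\sum_(i <- s) M i) => t x te.
  by rewrite (le_trans (ler_norm_sum _ _ _))// ler_sum// => i _; exact: dM.
have M0 : 0 <= M.
  have [x _] := probability_nonempty P.
  by rewrite (le_trans _ (dM e x _))// lerDl.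
have Iuv t : `]e - 1, e + 1[%classic t -> `|t| <= `|e| + 1.
  rewrite /= in_itv/= -ltr_distl => te.
  by rewrite -(subrK e t) addrC (le_trans (ler_normD _ _))// lerD2l ltW// distrC.
have Ie : `]e - 1, e + 1[%classic e by rewrite /= in_itv/= ltrDl gtrDl ltrN10 ltr01.
have H1 t : `]e - 1, e + 1[%classic t ->
    P.-integrable setT (EFin \o line_integrand s v w gs c t).
  move=> _; apply: bounded_measurable_integrable.
  exact: bounded_measurable_line_integrand.
have H2 t x : `]e - 1, e + 1[%classic t -> setT x ->
    derivable (line_integrand s v w gs c ^~ x) t 1.
  by move=> _ _; have [] := is_derive_line_integrand v w us ga c x t.
have H3 : P.-integrable setT (EFin \o (fun=> M) : T -> \bar R).
  exact: finite_measure_integrable_cst.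
have H4 t x : `]e - 1, e + 1[%classic t -> setT x ->
    `|partial1of2 (line_integrand s v w gs c) t x| <= M.
  by move=> /Iuv te _; rewrite d1E; exact: dM.
apply: DeriveDef.
  exact: (derivable_under_integral measurableT Ie H1 H2 (fun=> M0) H3 H4).
rewrite -derive1E.
rewrite (differentiation_under_integral measurableT Ie H1 H2 (fun=> M0) H3 H4).
rewrite /line_integral -Rintegral_sum; last first.
  move=> i; apply: bounded_measurable_integrable.
  by apply: bounded_measurable_line_integrand => //; exact: real_analytic_derive_at.
by apply: eq_Rintegral => x _; rewrite d1E.
Qed.

End line_integral_derive.

(** * Marginals of the Lebesgue measure on the cube *)

Section integral_mrestr.
Context d (T : measurableType d) (R : realType).
Variables (mu : {measure set T -> \bar R}) (D : set T) (mD : measurable D).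

(** The complement of [D] is negligible for the restricted measure, and on
    subsets of [D] the two measures agree. *)
Lemma ge0_integral_mrestr (f : T -> \bar R) :
  measurable_fun setT f -> (forall x, 0 <= f x)%E ->
  (\int[mrestr mu mD]_x f x = \int[mu]_(x in D) f x)%E.
Proof.
move=> mf f0.
have mC : measurable (~` D) by exact: measurableC.
rewrite [LHS](ge0_negligible_integral mC)//; last first.
  by rewrite /= /mrestr setICl measure0.
rewrite setTD setCK; apply: eq_measure_integral => A mA AD.
by rewrite /= /mrestr setIidl.
Qed.

End integral_mrestr.

Section cube.
Variable R : realType.
Local Notation mR := (measurableTypeR R).

Definition box q (C : 'I_q -> set mR) : set (q.-tuple mR) :=
  [set x | forall i, C i (tnth x i)].

Lemma measurable_box q (C : 'I_q -> set mR) :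
  (forall i, measurable (C i)) -> measurable (box C).
Proof.
move=> mC; rewrite (_ : box C = \bigcap_(i in setT) ((fun x => tnth x i) @^-1` C i)).
  apply: fin_bigcap_measurable => // i _.
  by rewrite -[X in measurable X]setTI; exact: measurable_tnth.
by apply/seteqP; split=> x /= h i => [_|]; exact: h.
Qed.

Lemma leb01_fin_num (A : set mR) : measurable A -> leb01 R A \is a fin_num.
Proof. by move=> mA; exact: fin_num_measure. Qed.

Lemma leb01_cube_box q (C : 'I_q -> set mR) : (forall i, measurable (C i)) ->
  leb01_cube R q (box C) = (\prod_(i < q) fine (leb01 R (C i)))%:E.
Proof.
elim: q C => [C _|q IH C mC].
  rewrite big_ord0 /= diracE mem_set//; by case.
rewrite big_ord_recl EFinM fineK ?leb01_fin_num//.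
rewrite -(IH (fun i => C (lift ord0 i)))//.
rewrite -product_measure1E//; last by apply: measurable_box.
rewrite /= /distribution /pushforward; congr (_ _).
apply/seteqP; split=> -[z x] /=.
  move=> h; split; first exact: (h ord0).
  by move=> i; have := h (lift ord0 i); rewrite tnthS.
move=> [h0 h] i; case: (unliftP ord0 i) => [j ->|->]; last exact: h0.
by rewrite tnthS; exact: h.
Qed.

Definition two_coords q (a b : 'I_q) (x : q.-tuple mR) : mR * mR :=
  (tnth x a, tnth x b).

Lemma measurable_two_coords q (a b : 'I_q) :
  measurable_fun setT (two_coords a b).
Proof. by apply: measurable_fun_pair; exact: measurable_tnth. Qed.

Section two_coords_box.
Variables (q : nat) (a b : 'I_q) (C : 'I_q -> set mR).
Hypothesis ab : a != b.
Hypothesis mC : forall i, measurable (C i).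

Let mbox : measurable (box C) := measurable_box mC.

Let mCab : measurable (C a `*` C b) := measurableX (mC a) (mC b).

Definition other_volume : R := \prod_(i | (i != a) && (i != b)) fine (leb01 R (C i)).

Lemma other_volume_ge0 : 0 <= other_volume.
Proof. by apply: prodr_ge0 => i _; exact: fine_ge0. Qed.

Let kappa : {nonneg R} := NngNum other_volume_ge0.

Lemma cube_two_coords_rect (A B : set mR) : measurable A -> measurable B ->
  (leb01_cube R q (two_coords a b @^-1` (A `*` B) `&` box C) =
   other_volume%:E * (leb01 R (A `&` C a) * leb01 R (B `&` C b)))%E.
Proof.
move=> mA mB.
pose D i := if i == a then A `&` C a else if i == b then B `&` C b else C i.
have -> : two_coords a b @^-1` (A `*` B) `&` box C = box D.
  apply/seteqP; split=> x /=.
    move=> [[xA xB] xC] i; rewrite /D; case: eqP => [->//|_].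
    by case: eqP => [->//|_].
  move=> h.
  have [xA xCa] : (A `&` C a) (tnth x a) by have := h a; rewrite /D eqxx.
  have [xB xCb] : (B `&` C b) (tnth x b).
    by have := h b; rewrite /D eq_sym (negPf ab) eqxx.
  by split=> // i; have := h i; rewrite /D; do 2 (case: eqP => [->//|_]).
rewrite leb01_cube_box; last first.
  by move=> i; rewrite /D; case: ifP => // _; [|case: ifP => // _]; exact: measurableI.
rewrite (bigD1 a)//= (bigD1 b)/=; last by rewrite eq_sym.
rewrite /D eqxx (eq_sym b) (negPf ab) eqxx mulrA mulrC EFinM; congr (_ * _)%E.
  congr (_ %:E); apply: eq_big => // i /andP[ia ib].
  by rewrite (negPf ia) (negPf ib).
by rewrite EFinM !fineK// leb01_fin_num//; exact: measurableI.
Qed.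

(** Integrating out the coordinates other than [a] and [b]. Both sides are
    integrals of [f] against measures on the plane that coincide with one product
    measure on rectangles, hence everywhere. *)
Lemma ge0_integral_box_two_coords (f : mR * mR -> \bar R) :
  measurable_fun setT f -> (forall z, 0 <= f z)%E ->
  (\int[leb01_cube R q]_(x in box C) f (two_coords a b x) =
   other_volume%:E * \int[leb01sq R]_(z in C a `*` C b) f z)%E.
Proof.
move=> mf f0.
have m2 := measurable_two_coords a b.
rewrite -(ge0_integral_mrestr _ mbox)//; last exact: measurableT_comp.
rewrite -(ge0_integral_mrestr _ mCab)//.
rewrite -(@ge0_integral_mscale _ _ _ _ _ measurableT kappa)//.
transitivity (\int[pushforward (mrestr (leb01_cube R q) mbox) (two_coords a b)]_z f z)%E.
  by rewrite ge0_integral_pushforward.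
apply: eq_measure_integral => X mX _.
(* The constant is put on the first factor of the product measure. *)
pose m1 := mscale kappa (mrestr (leb01 R) (mC a)).
pose m2' := mrestr (leb01 R) (mC b).
rewrite /=.
transitivity ((m1 \x m2')%E X).
  apply/esym/product_measure_unique => // A B mA mB.
  by have := cube_two_coords_rect mA mB; rewrite muleA.
apply: product_measure_unique => // A B mA mB.
transitivity (other_volume%:E * leb01sq R ((A `&` C a) `*` (B `&` C b)))%E.
  by rewrite setXI.
rewrite [leb01sq R _]product_measure1E; [|exact: measurableI..].
by rewrite muleA.
Qed.

Lemma integral_box_two_coords_eq0 (f : mR * mR -> R) :
  (leb01sq R).-integrable setT (EFin \o f) ->
  \int[leb01sq R]_(z in C a `*` C b) f z = 0 ->
  \int[leb01_cube R q]_(x in box C) f (two_coords a b x) = 0.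
Proof.
move=> fi f0.
have mf : measurable_fun setT (EFin \o f) by case/integrableP : fi.
have fi' : (leb01sq R).-integrable (C a `*` C b) (EFin \o f).
  by apply: integrableS fi.
have : (\int[leb01sq R]_(z in C a `*` C b) (EFin \o f) z)%E = 0%E.
  rewrite -[LHS]fineK ?(integrable_fin_num mCab fi')//.
  by rewrite -[X in fine X]/(\int[_]_(z in _) (f z)%:E)%E -/(Rintegral _ _ _) f0.
rewrite integralE => /eqP; rewrite sube_eq ?add0e; last 2 first.
- exact: integrable_pos_fin_num.
- by rewrite fin_num_adde_defl// integrable_neg_fin_num.
move=> /eqP pn.
rewrite /Rintegral -[X in fine X]/(\int[_]_(x in _) ((EFin \o f) \o two_coords a b) x)%E.
rewrite integralE.
under eq_integral do rewrite funepos_comp/=.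
under [X in (_ - X)%E]eq_integral do rewrite funeneg_comp/=.
rewrite !ge0_integral_box_two_coords//; last 2 first.
- exact: measurable_funeneg.
- exact: measurable_funepos.
by rewrite pn subee// fin_numM// integrable_neg_fin_num.
Qed.

End two_coords_box.

Section two_coords.
Variables (q : nat) (a b : 'I_q).
Hypothesis ab : a != b.

(** Two distinct coordinates of a uniform point of the cube form a uniform
    point of the square: the box is taken to be the whole cube. *)
Lemma ge0_integral_two_coords (f : mR * mR -> \bar R) :
  measurable_fun setT f -> (forall z, 0 <= f z)%E ->
  (\int[leb01_cube R q]_x f (two_coords a b x) = \int[leb01sq R]_z f z)%E.
Proof.
move=> mf f0.
have := @ge0_integral_box_two_coords q a b (fun=> setT) ab (fun=> measurableT) f mf f0.
rewrite (_ : box _ = setT); last by apply/seteqP; split.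
rewrite setXTT => ->.
rewrite /other_volume big1 ?mul1e// => i _.
by rewrite -[leb01 R setT]/(leb01 R setT) probability_setT.
Qed.

Lemma integrable_two_coords (f : mR * mR -> R) :
  (leb01sq R).-integrable setT (EFin \o f) ->
  (leb01_cube R q).-integrable setT (EFin \o (f \o two_coords a b)).
Proof.
move=> /integrableP[mf fi]; apply/integrableP; split.
  by apply: (measurableT_comp mf); exact: measurable_two_coords.
move: fi; rewrite -(ge0_integral_two_coords (f := fun z => `|(EFin \o f) z|%E))//.
exact: measurableT_comp.
Qed.

Lemma integral_two_coords (f : mR * mR -> R) : measurable_fun setT f ->
  \int[leb01_cube R q]_x f (two_coords a b x) = \int[leb01sq R]_z f z.
Proof.
move=> mf; have mF : measurable_fun setT (EFin \o f) by exact/measurable_EFinP.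
congr fine; rewrite -[LHS]/(\int[_]_x ((EFin \o f) \o two_coords a b) x)%E.
rewrite -[RHS]/(\int[_]_x (EFin \o f) x)%E.
rewrite [LHS]integralE [RHS]integralE.
under eq_integral do rewrite funepos_comp/=.
under [X in (_ - X)%E]eq_integral do rewrite funeneg_comp/=.
rewrite !ge0_integral_two_coords//.
- exact: measurable_funeneg.
- exact: measurable_funepos.
Qed.

Lemma Lnorm_two_coords (f : mR * mR -> R) : measurable_fun setT f ->
  ('N[leb01_cube R q]_2%:E[EFin \o (f \o two_coords a b)] =
   'N[leb01sq R]_2%:E[EFin \o f])%E.
Proof.
move=> mf; rewrite unlock; congr (_ `^ _)%E.
rewrite -(ge0_integral_two_coords (f := fun z => (`|(EFin \o f) z| `^ 2)%E))//.
- exact: measurable_abse_sqr.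
- by move=> z; exact: poweR_ge0.
Qed.

Lemma Lfun2_two_coords (f : mR * mR -> R) :
  f \in Lfun (leb01sq R) 2%:E -> f \o two_coords a b \in Lfun (leb01_cube R q) 2%:E.
Proof.
rewrite !inE => /andP[/[!inE]/= mf ff]; apply/andP; split; rewrite inE/=.
  by apply: measurableT_comp => //; exact: measurable_two_coords.
by move: ff; rewrite /finite_norm Lnorm_two_coords.
Qed.

End two_coords.
End cube.

(** * Functions that are constant on products of cells *)

Section cells.
Variables (R : realType) (m : nat) (pi : 'I_m -> R).
Hypothesis pi_gt0 : forall i, 0 < pi i.
Hypothesis pi_sum : \sum_(i < m) pi i = 1.
Local Notation mR := (measurableTypeR R).

Lemma cumul0 : cumul pi 0 = 0.
Proof. by rewrite /cumul big1. Qed.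

Lemma cumul_end : cumul pi m = 1.
Proof. by rewrite /cumul -pi_sum; apply: eq_bigl => i; rewrite ltn_ord. Qed.

Lemma cumulS (i : 'I_m) : cumul pi i.+1 = cumul pi i + pi i.
Proof.
rewrite /cumul (bigD1 i)//= addrC; congr (_ + _); apply: eq_bigl => j.
by rewrite ltnS (ltn_neqAle j) andbC.
Qed.

Lemma le_cumul j k : (j <= k)%N -> cumul pi j <= cumul pi k.
Proof.
move=> jk; rewrite /cumul big_mkcond [leRHS]big_mkcond; apply: ler_sum => i _.
have := ltW (pi_gt0 i).
by case: ltnP => [ij|_]; [rewrite (leq_trans ij jk)|case: ifP].
Qed.

Lemma cellE (i : 'I_m) t :
  cell pi i t <-> cumul pi i <= t /\
    (if (i.+1 < m)%N then t < cumul pi i.+1 else t <= cumul pi i.+1).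
Proof.
rewrite /cell /=; case: (i.+1 < m)%N; rewrite in_itv/=.
  by split=> [/andP[]|[-> ->]].
by split=> [/andP[]|[-> ->]].
Qed.

Lemma measurable_cell i : measurable (cell pi i : set mR).
Proof. exact: measurable_itv. Qed.

Lemma cell_disjoint i j t : cell pi i t -> cell pi j t -> i = j.
Proof.
have wl (i' j' : 'I_m) : (i' < j')%N -> cell pi i' t -> cell pi j' t -> False.
  move=> ij /cellE[_]; rewrite (leq_ltn_trans ij (ltn_ord j')) => ti /cellE[tj _].
  by have := le_cumul ij; rewrite leNgt (le_lt_trans tj ti).
move=> it jt; apply/val_inj; case: (ltngtP i j) => // ij.
  by case: (wl _ _ ij it jt).
by case: (wl _ _ ij jt it).
Qed.

(** Climbing the cumulated lengths, either some interval on the way contains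
    [t] or its left end stays below [t]; at the end [t = 1], which belongs to the
    last interval because that one is closed. *)
Lemma cell_cover (t : R) : 0 <= t <= 1 -> exists i, cell pi i t.
Proof.
move=> /andP[t0 t1].
have m0 : (0 < m)%N.
  rewrite lt0n; apply/eqP => m0; have := pi_sum.
  rewrite big1 => [/esym/eqP|i _]; first by rewrite oner_eq0.
  by have := ltn_ord i; rewrite [X in (_ < X)%N]m0.
have step_ j : (j <= m)%N -> (exists i, cell pi i t) \/ cumul pi j <= t.
  elim: j => [_|j IH jm]; first by right; rewrite cumul0.
  have [|jt] := IH (ltnW jm); first by left.
  have [tj|tj] := ltP t (cumul pi j.+1); last by right.
  left; exists (Ordinal jm); apply/cellE; split=> //=.
  by case: ifP => // _; exact: ltW.
have [//|mt] := step_ m (leqnn m).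
have mm : (m.-1 < m)%N by rewrite prednK.
exists (Ordinal mm); apply/cellE => /=; rewrite prednK// ltnn cumul_end; split=> //.
by apply: le_trans mt; apply: le_cumul; exact: leq_pred.
Qed.

Lemma leb01_cell i : leb01 R (cell pi i) = (pi i)%:E.
Proof.
rewrite /leb01 /mrestr setIidl; last first.
  move=> t /cellE[t0 t1]; rewrite /= in_itv/=.
  rewrite (le_trans _ t0) -?cumul0 ?le_cumul//=.
  rewrite -cumul_end (@le_trans _ _ (cumul pi i.+1))// ?le_cumul//.
  by move: t1; case: ifP => // _ /ltW.
have h : cumul pi i < cumul pi i.+1 by rewrite cumulS ltrDl.
rewrite [X in lebesgue_measure X]/cell lebesgue_measure_itv/= lte_fin h.
by rewrite -EFinB cumulS addrAC subrr add0r.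
Qed.

(** The common form of step functions and of block averages. *)
Definition block_fun (c : 'I_m -> 'I_m -> R) (z : R * R) : R :=
  \sum_(i < m) \sum_(j < m) c i j * \1_(cell pi i `*` cell pi j) z.

Lemma block_fun_cell c p q z :
  cell pi p z.1 -> cell pi q z.2 -> block_fun c z = c p q.
Proof.
move=> zp zq; rewrite /block_fun (bigD1 p)//= (bigD1 q)//=.
rewrite indicE mem_set; last by split.
rewrite mulr1 !big1 ?addr0// => [i ip|j jq].
  rewrite big1// => j _; rewrite indicE memNset ?mulr0// => -[/= zi _].
  by move: ip; rewrite (cell_disjoint zi zp) eqxx.
rewrite indicE memNset ?mulr0// => -[/= _ zj].
by move: jq; rewrite (cell_disjoint zj zq) eqxx.
Qed.

Lemma bounded_measurable_block_fun c :
  bounded_measurable (block_fun c : mR * mR -> R).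
Proof.
apply: bounded_measurable_sum => i; apply: bounded_measurable_sum => j.
apply: bounded_measurableZ; split.
  apply: measurable_indic; apply: measurableX; exact: measurable_cell.
by exists 1 => z _; rewrite indicE; case: (_ \in _); rewrite ?normr1 ?normr0.
Qed.

Lemma block_fun_swap c : (forall i j, c i j = c j i) ->
  forall z, block_fun c z = block_fun c (z.2, z.1).
Proof.
move=> cs [x y]; rewrite /block_fun exchange_big/=; apply: eq_bigr => i _.
apply: eq_bigr => j _; rewrite cs !indicE; congr (_ * (nat_of_bool _)%:R).
apply/idP/idP; rewrite !inE => -[]; by split.
Qed.

Section cube_blocks.
Variable q : nat.
Implicit Type c : {ffun 'I_q -> 'I_m}.

Definition cell_box c : set (q.-tuple mR) := box (fun i => cell pi (c i)).

Lemma measurable_cell_box c : measurable (cell_box c).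
Proof. by apply: measurable_box => i; exact: measurable_cell. Qed.

Let unit_box : set (q.-tuple mR) := box (fun=> `[0, 1]%classic).

Lemma sum_cell_box x : unit_box x -> \sum_c \1_(cell_box c) x = 1 :> R.
Proof.
move=> x01.
have /choice[f xf] i : exists j, cell pi j (tnth x i).
  by apply: cell_cover; have := x01 i; rewrite /= in_itv.
pose c0 : {ffun 'I_q -> 'I_m} := [ffun i => f i].
rewrite (bigD1 c0)//= indicE mem_set; last by move=> i; rewrite ffunE.
rewrite big1 ?addr0// => c cc0; rewrite indicE memNset// => xc.
move/eqP: cc0; apply; apply/ffunP => i; rewrite ffunE.
exact: cell_disjoint (xc i) (xf i).
Qed.

(** Up to a null set the cube is the disjoint union of the boxes whose sides
    are cells, one box for each assignment of cells to coordinates. *)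
Lemma integral_cell_boxes (F : q.-tuple mR -> R) :
  (leb01_cube R q).-integrable setT (EFin \o F) ->
  \int[leb01_cube R q]_x F x = \sum_c \int[leb01_cube R q]_(x in cell_box c) F x.
Proof.
move=> iF.
have m01 : measurable unit_box by apply: measurable_box => i; exact: measurable_itv.
have mC : measurable (~` unit_box) by exact: measurableC.
have nC : leb01_cube R q (~` unit_box) = 0%E.
  rewrite probability_setC// leb01_cube_box; last by move=> i; exact: measurable_itv.
  rewrite big1 ?subee// => i _.
  by rewrite /leb01 /mrestr setIid lebesgue_measure_itv/= lte_fin ltr01 oppr0 adde0.
have cut G : (leb01_cube R q).-integrable setT (EFin \o G) ->
    \int[leb01_cube R q]_x G x = \int[leb01_cube R q]_(x in unit_box) G x.
  move=> iG; congr fine; rewrite (negligible_integral mC)//.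
  by rewrite setTD setCK.
have iFc c : (leb01_cube R q).-integrable setT (EFin \o (F \_ (cell_box c))).
  rewrite -restrict_EFin; apply/(integrable_mkcond _ (measurable_cell_box c)).
  by apply: integrableS iF => //; exact: measurable_cell_box.
under eq_bigr do rewrite Rintegral_mkcond.
rewrite -Rintegral_sum// cut// [RHS]cut; last first.
  rewrite (_ : _ \o _ = (fun x => \sum_c (EFin \o (F \_ (cell_box c))) x)%E).
    by apply: integrable_sum => // c _; exact: iFc.
  by apply/funext => x /=; rewrite sumEFin.
apply: eq_Rintegral => x; rewrite inE => /sum_cell_box x1.
rewrite -[LHS]mulr1 -x1 mulr_sumr; apply: eq_bigr => c _.
by rewrite patchE indicE; case: (x \in _); rewrite ?mulr1 ?mulr0.
Qed.

(** Existence of a value for each box, rather than a value computed from the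
    assignment, makes the notion stable under products and compositions without
    choosing points in the boxes. *)
Definition block_constant (H : q.-tuple mR -> R) : Prop :=
  forall c, exists h, forall x, cell_box c x -> H x = h.

Lemma block_constantM H G : block_constant H -> block_constant G ->
  block_constant (fun x => H x * G x).
Proof.
move=> bH bG c; have [h Hh] := bH c; have [g Gg] := bG c.
by exists (h * g) => x xc; rewrite Hh// Gg.
Qed.

Lemma block_constant_prod (I : Type) (s : seq I) (H : I -> q.-tuple mR -> R) :
  (forall i, block_constant (H i)) ->
  block_constant (fun x => \prod_(i <- s) H i x).
Proof.
move=> bH; elim: s => [|i s IH].
  by under eq_fun do rewrite big_nil; move=> c; exists 1.
by under eq_fun do rewrite big_cons; exact: block_constantM.
Qed.

Lemma block_constant_comp (g : R -> R) (c : 'I_m -> 'I_m -> R) (a b : 'I_q) :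
  block_constant (fun x => g (block_fun c (two_coords a b x))).
Proof.
move=> e; exists (g (c (e a) (e b))) => x xe; congr g.
by apply: block_fun_cell; exact: xe.
Qed.

(** The vanishing mechanism behind the theorem: on each box [H] is a constant
    and the other coordinates integrate out, leaving a multiple of the integral
    of [f] over one product of two cells. The coordinates [a] and [b] must be
    distinct for that product to be two-dimensional. *)
Lemma integral_block_constant_eq0 (H : q.-tuple mR -> R) (f : mR * mR -> R)
    (a b : 'I_q) : a != b -> bounded_measurable H -> block_constant H ->
  (leb01sq R).-integrable setT (EFin \o f) ->
  (forall i j, \int[leb01sq R]_(z in cell pi i `*` cell pi j) f z = 0) ->
  \int[leb01_cube R q]_x (H x * f (two_coords a b x)) = 0.
Proof.
move=> ab bH cH fi f0.
have fi2 := integrable_two_coords ab fi.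
rewrite integral_cell_boxes; last first.
  exact: (integrableMr measurableT (proj1 bH) (bounded_measurable_bounded bH) fi2).
rewrite big1// => c _; have [h Hh] := cH c.
transitivity (\int[leb01_cube R q]_(x in cell_box c) (h * f (two_coords a b x))).
  by apply: eq_Rintegral => x; rewrite inE => xc; rewrite Hh.
rewrite RintegralZl; [|exact: measurable_cell_box|]; last first.
  by apply: integrableS fi2 => //; exact: measurable_cell_box.
rewrite (integral_box_two_coords_eq0 (C := fun i => cell pi (c i)))// ?mulr0//.
by move=> i; exact: measurable_cell.
Qed.

End cube_blocks.

Section averages.
Variables (r : nat) (eta : kernels R r) (k : 'I_r).

Lemma block_avgE : block_avg pi eta k = block_fun (fun i j =>
  (pi i * pi j)^-1 * \int[leb01sq R]_(w in cell pi i `*` cell pi j) eta k w).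
Proof. by []. Qed.

(** The average over a product of cells is the integral divided by
    [pi i * pi j], which is the area of that product. *)
Lemma integral_cells_block_perp i j :
  (leb01sq R).-integrable setT (EFin \o eta k) ->
  \int[leb01sq R]_(z in cell pi i `*` cell pi j) block_perp pi eta k z = 0.
Proof.
move=> ei; have mij : measurable (cell pi i `*` cell pi j : set (mR * mR)).
  by apply: measurableX; exact: measurable_cell.
have ba := bounded_measurable_block_fun (fun i j =>
  (pi i * pi j)^-1 * \int[leb01sq R]_(w in cell pi i `*` cell pi j) eta k w).
rewrite /block_perp RintegralB//; last 2 first.
- exact: integrableS ei.
- by apply: integrableS (bounded_measurable_integrable (leb01sq R) ba).
apply/eqP; rewrite subr_eq0; apply/eqP/esym.
transitivity (\int[leb01sq R]_(z in cell pi i `*` cell pi j)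
    ((pi i * pi j)^-1 * \int[leb01sq R]_(w in cell pi i `*` cell pi j) eta k w)).
  apply: eq_Rintegral => z; rewrite inE => -[zi zj].
  by rewrite block_avgE (block_fun_cell _ zi zj).
have vol : leb01sq R (cell pi i `*` cell pi j) = (pi i * pi j)%:E.
  rewrite [LHS]product_measure1E; [|exact: measurable_cell..].
  by rewrite EFinM; congr (_ * _)%E; exact: leb01_cell.
rewrite Rintegral_cst// (_ : fine _ = pi i * pi j); last exact: (congr1 fine vol).
by rewrite mulrC mulrA mulfV ?mul1r// gt_eqF// mulr_gt0.
Qed.

End averages.

End cells.

(** * Square integrable functions *)

Section L2.
Context (R : realType) d (T : measurableType d) (P : probability T R).
Implicit Types f g H : T -> R.

Definition norm2 f : R := fine ('N[P]_2%:E[EFin \o f])%E.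

Lemma norm2_ge0 f : 0 <= norm2 f.
Proof. by rewrite fine_ge0// Lnorm_ge0. Qed.

Lemma Lfun2_fin_num f : f \in Lfun P 2%:E ->
  ('N[P]_2%:E[EFin \o f])%E \is a fin_num.
Proof.
rewrite inE => /andP[_]; rewrite inE/= /finite_norm => h.
by rewrite ge0_fin_numE// Lnorm_ge0.
Qed.

Lemma Lfun2_measurable f : f \in Lfun P 2%:E -> measurable_fun setT f.
Proof. by rewrite inE => /andP[]; rewrite inE. Qed.

Lemma Lfun2_integrable f : f \in Lfun P 2%:E -> P.-integrable setT (EFin \o f).
Proof.
move=> f2; apply/Lfun1_integrable; apply: Lfun_subset12 => //.
exact: fin_num_measure.
Qed.

Lemma Lfun2D f g : f \in Lfun P 2%:E -> g \in Lfun P 2%:E ->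
  (fun x => f x + g x) \in Lfun P 2%:E.
Proof. by move=> f2 g2; exact: (Lfun_addr_closed P (lee1n 2)).2. Qed.

Lemma Lfun2B f g : f \in Lfun P 2%:E -> g \in Lfun P 2%:E ->
  (fun x => f x - g x) \in Lfun P 2%:E.
Proof.
move=> f2 g2; apply: (Lfun2D f2 (g := fun x => - g x)).
exact: (Lfun_oppr_closed g2).
Qed.

Lemma integrableM_Lfun2 f g : f \in Lfun P 2%:E -> g \in Lfun P 2%:E ->
  P.-integrable setT (EFin \o (fun x => f x * g x)).
Proof. by move=> f2 g2; apply/Lfun1_integrable; exact: Lfun2_mul_Lfun1. Qed.

Lemma integrable_bounded_Lfun2 H f g : bounded_measurable H ->
  f \in Lfun P 2%:E -> g \in Lfun P 2%:E ->
  P.-integrable setT (EFin \o (fun x => H x * (f x * g x))).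
Proof.
move=> bH f2 g2; have [mH _] := bH.
exact: (integrableMr measurableT mH (bounded_measurable_bounded bH)
  (integrableM_Lfun2 f2 g2)).
Qed.

Lemma bounded_measurable_Lfun2 f : bounded_measurable f -> f \in Lfun P 2%:E.
Proof.
move=> [mf [M fM]]; rewrite inE; apply/andP; split; rewrite inE//= /finite_norm.
have := @Lfun_cst _ _ _ P M 2; rewrite inE => /andP[_]; rewrite inE/= /finite_norm.
apply: le_lt_trans; rewrite unlock gt0_ler_poweR//.
- by rewrite in_itv/= leey integral_ge0// => x _; exact: poweR_ge0.
- by rewrite in_itv/= leey integral_ge0// => x _; exact: poweR_ge0.
apply: ge0_le_integral => //.
- by move=> x _; exact: poweR_ge0.
- exact: measurable_abse_sqr.
- exact: (@measurable_abse_sqr _ _ _ (cst M)).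
move=> x _; rewrite lee_fin ge0_ler_powR//.
by rewrite (le_trans (fM x I))// ler_norm.
Qed.

Lemma cauchy_schwarz f g : f \in Lfun P 2%:E -> g \in Lfun P 2%:E ->
  \int[P]_x `|f x * g x| <= norm2 f * norm2 g.
Proof.
move=> f2 g2.
have := @hoelder _ _ _ P f g 2 2 (Lfun2_measurable f2) (Lfun2_measurable g2).
rewrite [2^-1 + 2^-1](_ : _ = 1); last by rewrite [RHS]splitr !div1r.
rewrite Lnorm1 => /(_ (ltr0Sn _ 1) (ltr0Sn _ 1) erefl).
rewrite -(fineK (Lfun2_fin_num f2)) -(fineK (Lfun2_fin_num g2)) -EFinM => h.
rewrite -lee_fin (le_trans _ h)// /Rintegral fineK//.
have := integrable_abse (integrableM_Lfun2 f2 g2).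
by move=> /(integrable_fin_num measurableT).
Qed.

Lemma bounded_cauchy_schwarz H f g (M : R) : bounded_measurable H ->
  (forall x, `|H x| <= M) -> f \in Lfun P 2%:E -> g \in Lfun P 2%:E ->
  `|\int[P]_x (H x * (f x * g x))| <= M * (norm2 f * norm2 g).
Proof.
move=> bH HM f2 g2.
have ia := integrable_abse (integrableM_Lfun2 f2 g2).
have iH := integrable_bounded_Lfun2 bH f2 g2.
have M0 : 0 <= M.
  have [x _] := probability_nonempty P.
  exact: le_trans (HM x).
apply: (le_trans (le_normr_Rintegral measurableT iH)).
apply: (@le_trans _ _ (\int[P]_x (M * `|f x * g x|))).
  apply: le_Rintegral => //.
  - exact: (integrable_abse iH).
  - have := @integrableZl _ _ _ P setT measurableT M _ ia.
    by [].
  - by move=> x _; rewrite normrM ler_wpM2r.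
rewrite RintegralZl//.
by rewrite ler_wpM2l// cauchy_schwarz.
Qed.

End L2.

Lemma norm2_two_coords (R : realType) q (a b : 'I_q)
    (f : measurableTypeR R * measurableTypeR R -> R) : a != b ->
  measurable_fun setT f ->
  norm2 (leb01_cube R q) (f \o two_coords a b) = norm2 (leb01sq R) f.
Proof. by move=> ab mf; rewrite /norm2 Lnorm_two_coords. Qed.

(** * Second variation forms *)

Section forms.
Variables (R : realType) (r m : nat) (pi : 'I_m -> R).
Local Notation mR := (measurableTypeR R).
Implicit Types (V eta zeta xi : kernels R r) (L : kernels R r -> R).

Definition tuple_L2 eta := forall k, (eta k : mR * mR -> R) \in Lfun (leb01sq R) 2%:E.

Definition tuple_bounded zeta :=
  forall k, bounded_measurable (zeta k : mR * mR -> R).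

Definition tuple_norm eta : R := \sum_(k < r) norm2 (leb01sq R) (eta k).

Lemma tuple_norm_ge0 eta : 0 <= tuple_norm eta.
Proof. by apply: sumr_ge0 => k _; exact: norm2_ge0. Qed.

Lemma norm2_le_tuple_norm eta k : norm2 (leb01sq R) (eta k) <= tuple_norm eta.
Proof.
by rewrite /tuple_norm (bigD1 k)//= lerDl sumr_ge0// => i _; exact: norm2_ge0.
Qed.

Definition tuple_add eta zeta : kernels R r := fun k z => eta k z + zeta k z.

Lemma tuple_L2D eta zeta : tuple_L2 eta -> tuple_L2 zeta ->
  tuple_L2 (tuple_add eta zeta).
Proof. by move=> he hz k; apply: Lfun2D; [exact: he|exact: hz]. Qed.

Lemma tuple_bounded_L2 zeta : tuple_bounded zeta -> tuple_L2 zeta.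
Proof. by move=> bz k; exact: bounded_measurable_Lfun2. Qed.

(** The bilinear form is an argument and not a value computed from [L]: all that
    is needed of the second variation is that some form with these properties
    represents it on bounded directions. Since the properties are stable under
    linear combinations, they need proof for a single graph density only. The
    derivative [dL] is required along the whole line because the second derivative
    at 0 is that of the first derivative as a function. *)
Record second_variation_form V L (B : kernels R r -> kernels R r -> R) : Prop :=
  SecondVariationForm {
  svf_derive : forall zeta, tuple_bounded zeta -> exists dL : R -> R,
    (forall e : R, is_derive e (1 : R)
      (fun t : R => L (fun k z => V k z + t * zeta k z)) (dL e)) /\
    is_derive (0 : R) (1 : R) dL (B zeta zeta) ;
  svf_addl : forall eta zeta xi, tuple_L2 eta -> tuple_L2 zeta -> tuple_L2 xi ->
    B (tuple_add eta zeta) xi = B eta xi + B zeta xi ;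
  svf_addr : forall eta zeta xi, tuple_L2 eta -> tuple_L2 zeta -> tuple_L2 xi ->
    B xi (tuple_add eta zeta) = B xi eta + B xi zeta ;
  svf_bound : exists2 C, 0 <= C & forall eta zeta, tuple_L2 eta ->
    tuple_L2 zeta -> `|B eta zeta| <= C * (tuple_norm eta * tuple_norm zeta) ;
  svf_cross : forall eta, tuple_L2 eta ->
    B (block_avg pi eta) (block_perp pi eta) = 0 /\
    B (block_perp pi eta) (block_avg pi eta) = 0 }.

Lemma second_variation_form_cst V (c : R) :
  second_variation_form V (fun=> c) (fun _ _ => 0).
Proof.
split.
- move=> zeta _; exists (fun=> 0); split=> [e|]; exact: is_derive_cst.
- by move=> *; rewrite addr0.
- by move=> *; rewrite addr0.
- by exists 0 => // *; rewrite normr0 mul0r.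
- by [].
Qed.

Lemma second_variation_formD V L1 L2 B1 B2 :
  second_variation_form V L1 B1 -> second_variation_form V L2 B2 ->
  second_variation_form V (fun W => L1 W + L2 W) (fun x y => B1 x y + B2 x y).
Proof.
move=> [d1 al1 ar1 [C1 C10 b1] c1] [d2 al2 ar2 [C2 C20 b2] c2]; split.
- move=> zeta bz; have [dL1 [h1 k1]] := d1 _ bz; have [dL2 [h2 k2]] := d2 _ bz.
  exists (fun t => dL1 t + dL2 t); split=> [e|].
    exact: (is_deriveD (h1 e) (h2 e)).
  exact: (is_deriveD k1 k2).
- by move=> *; rewrite al1// al2// addrACA.
- by move=> *; rewrite ar1// ar2// addrACA.
- exists (C1 + C2); first exact: addr_ge0.
  move=> eta zeta he hz; rewrite (le_trans (ler_normD _ _))// mulrDl lerD//.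
    exact: b1.
  exact: b2.
- by move=> eta he; have [-> ->] := c1 _ he; have [-> ->] := c2 _ he; rewrite addr0.
Qed.

Lemma second_variation_formZ V L B (c : R) : second_variation_form V L B ->
  second_variation_form V (fun W => c * L W) (fun x y => c * B x y).
Proof.
move=> [d al ar [C C0 b] cr]; split.
- move=> zeta bz; have [dL [h k]] := d _ bz.
  exists (fun t => c * dL t); split=> [e|].
    exact: (is_deriveZ c (h e)).
  exact: (is_deriveZ c k).
- by move=> *; rewrite al// mulrDr.
- by move=> *; rewrite ar// mulrDr.
- exists (`|c| * C); first exact: mulr_ge0.
  by move=> eta zeta he hz; rewrite normrM -mulrA ler_wpM2l// b.
- by move=> eta he; have [-> ->] := cr _ he; rewrite mulr0.
Qed.

Lemma second_variation_form_sum V (I : Type) (s : seq I)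
    (L : I -> kernels R r -> R) :
  (forall i, exists B, second_variation_form V (L i) B) ->
  exists B, second_variation_form V (fun W => \sum_(i <- s) L i W) B.
Proof.
move=> h; elim: s => [|i s [B hB]].
  exists (fun _ _ => 0); under eq_fun do rewrite big_nil.
  exact: second_variation_form_cst.
have [Bi hBi] := h i; exists (fun x y => Bi x y + B x y).
under eq_fun do rewrite big_cons.
exact: second_variation_formD.
Qed.

Lemma tuple_boundedD V zeta (e : R) : tuple_bounded V -> tuple_bounded zeta ->
  tuple_bounded (fun k z => V k z + e * zeta k z).
Proof.
move=> bV bz k; apply: bounded_measurableD; first exact: bV.
by apply: bounded_measurableZ; exact: bz.
Qed.

(** Only bounded tuples are ever fed to the functional, so two functionals
    that agree there have the same form. *)
Lemma second_variation_form_ext V L1 L2 B : tuple_bounded V ->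
  (forall W, tuple_bounded W -> L1 W = L2 W) ->
  second_variation_form V L1 B -> second_variation_form V L2 B.
Proof.
move=> bV L12 [d al ar b cr]; split=> // zeta bz.
have [dL [h k]] := d _ bz; exists dL; split=> // e.
have <- : (fun t : R => L1 (fun k z => V k z + t * zeta k z)) =
          (fun t : R => L2 (fun k z => V k z + t * zeta k z)).
  by apply/funext => t; apply: L12; exact: tuple_boundedD.
exact: h.
Qed.

End forms.

(** * The second variation of a graph density *)

Section graph_density_form.
Variables (R : realType) (r m : nat) (pi : 'I_m -> R).
Hypothesis pi_gt0 : forall i, 0 < pi i.
Hypothesis pi_sum : \sum_(i < m) pi i = 1.
Variables (F : mgraph r) (g : 'I_r -> R -> R).
Hypothesis ga : forall k, real_analytic (g k).
Variable A : 'I_r -> 'M[R]_m.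
Local Notation mR := (measurableTypeR R).
Local Notation q := (nverts F).
Local Notation J := ('I_r * ('I_q * 'I_q))%type.
Local Notation V := (step A pi).
Local Notation P := (leb01_cube R q).
Implicit Types (eta zeta xi W : kernels R r) (i j l : J).

Definition edge_seq : seq J := enum [pred j : J | j.2 \in edges F j.1].

(** A loop would have to be listed in both orientations. *)
Lemma edge_seq_neq j : j \in edge_seq -> j.2.1 != j.2.2.
Proof.
rewrite mem_enum inE; case: j => k [a b] /= kab; apply/eqP => ab.
by have := edges_once kab; rewrite -{1}ab {2}ab kab.
Qed.

Definition on_edge W j (x : q.-tuple mR) : R := W j.1 (two_coords j.2.1 j.2.2 x).

Lemma graph_densityE W :
  graph_density F W g = \int[P]_x \prod_(j <- edge_seq) g j.1 (on_edge W j x).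
Proof.
rewrite /graph_density; apply: eq_Rintegral => x _.
by rewrite pair_big_dep/= /edge_seq big_enum.
Qed.

Lemma bounded_measurable_on_edge W j : tuple_bounded W ->
  bounded_measurable (on_edge W j).
Proof.
by move=> bW; apply: bounded_measurable_precomp => //; exact: measurable_two_coords.
Qed.

Lemma tuple_bounded_step : tuple_bounded V.
Proof.
by move=> k; exact: (bounded_measurable_block_fun pi (fun s t => A k s t)).
Qed.

Lemma tuple_bounded_block_avg eta : tuple_bounded (block_avg pi eta).
Proof. by move=> k; rewrite block_avgE; exact: bounded_measurable_block_fun. Qed.

Lemma tuple_L2_block_perp eta : tuple_L2 eta -> tuple_L2 (block_perp pi eta).
Proof.
move=> he k; apply: Lfun2B; first exact: he.
exact: tuple_bounded_L2 (tuple_bounded_block_avg eta) k.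
Qed.

(** The product over all edges evaluated at the step function, with the factors
    of [i] and of [l] differentiated; when [i = l] that factor is differentiated
    twice. *)
Definition edge_coef i l (x : q.-tuple mR) : R :=
  \prod_(j <- edge_seq) derive_at (derive_at (fun j => g j.1) i) l j (on_edge V j x).

Definition edge_form i l zeta xi : R :=
  \int[P]_x (edge_coef i l x * (on_edge zeta i x * on_edge xi l x)).

Definition graph_form zeta xi : R :=
  \sum_(i <- edge_seq) \sum_(l <- edge_seq) edge_form i l zeta xi.

Lemma edge_fun_analytic i l j :
  real_analytic (derive_at (derive_at (fun j => g j.1) i) l j).
Proof. by do 2 (apply: real_analytic_derive_at => {}j); exact: ga. Qed.

Lemma bounded_measurable_edge_coef i l : bounded_measurable (edge_coef i l).
Proof.
apply: bounded_measurable_prod => j; apply: bounded_measurable_comp.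
  exact/real_analytic_continuous/edge_fun_analytic.
by apply: bounded_measurable_on_edge; exact: tuple_bounded_step.
Qed.

Lemma block_constant_edge_coef i l : block_constant pi (edge_coef i l).
Proof.
apply: block_constant_prod => j.
exact: (block_constant_comp pi_gt0 _ (fun s t => A j.1 s t)).
Qed.

Lemma Lfun2_on_edge eta j : tuple_L2 eta -> j \in edge_seq ->
  on_edge eta j \in Lfun P 2%:E.
Proof. by move=> he /edge_seq_neq jj; apply: Lfun2_two_coords. Qed.

Lemma norm2_on_edge eta j : tuple_L2 eta -> j \in edge_seq ->
  norm2 P (on_edge eta j) <= tuple_norm eta.
Proof.
move=> he /edge_seq_neq jj.
rewrite (norm2_two_coords jj); first exact: norm2_le_tuple_norm.
exact: Lfun2_measurable (he _).
Qed.

Lemma edge_form_addl i l eta zeta xi : i \in edge_seq -> l \in edge_seq ->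
  tuple_L2 eta -> tuple_L2 zeta -> tuple_L2 xi ->
  edge_form i l (tuple_add eta zeta) xi = edge_form i l eta xi + edge_form i l zeta xi.
Proof.
move=> iE lE he hz hx; rewrite /edge_form -RintegralD//; last 2 first.
- by apply: integrable_bounded_Lfun2;
    [exact: bounded_measurable_edge_coef|exact: Lfun2_on_edge..].
- by apply: integrable_bounded_Lfun2;
    [exact: bounded_measurable_edge_coef|exact: Lfun2_on_edge..].
by apply: eq_Rintegral => x _; rewrite -mulrDr -mulrDl.
Qed.

Lemma edge_form_addr i l eta zeta xi : i \in edge_seq -> l \in edge_seq ->
  tuple_L2 eta -> tuple_L2 zeta -> tuple_L2 xi ->
  edge_form i l xi (tuple_add eta zeta) = edge_form i l xi eta + edge_form i l xi zeta.
Proof.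
move=> iE lE he hz hx; rewrite /edge_form -RintegralD//; last 2 first.
- by apply: integrable_bounded_Lfun2;
    [exact: bounded_measurable_edge_coef|exact: Lfun2_on_edge..].
- by apply: integrable_bounded_Lfun2;
    [exact: bounded_measurable_edge_coef|exact: Lfun2_on_edge..].
by apply: eq_Rintegral => x _; rewrite -mulrDr -mulrDr.
Qed.

(** Cauchy-Schwarz on the cube, the coefficient being bounded and each edge
    reading a uniform point of the square. *)
Lemma edge_form_bound i l : exists2 C, 0 <= C &
  forall eta zeta, i \in edge_seq -> l \in edge_seq ->
  tuple_L2 eta -> tuple_L2 zeta ->
  `|edge_form i l eta zeta| <= C * (tuple_norm eta * tuple_norm zeta).
Proof.
have bc := bounded_measurable_edge_coef i l; have [_ [M cM]] := bc.
exists `|M| => // eta zeta iE lE he hz.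
have cM' x : `|edge_coef i l x| <= `|M| by rewrite (le_trans (cM x I))// ler_norm.
apply: (le_trans (bounded_cauchy_schwarz bc cM' (Lfun2_on_edge he iE)
  (Lfun2_on_edge hz lE))).
by rewrite ler_wpM2l// ler_pM ?norm2_ge0// norm2_on_edge.
Qed.

(** All factors except the one that carries the complement are constant on
    boxes of cells, and the complement has integral zero over each product of
    cells. *)
Lemma edge_form_cross i l eta : i \in edge_seq -> l \in edge_seq -> tuple_L2 eta ->
  edge_form i l (block_avg pi eta) (block_perp pi eta) = 0 /\
  edge_form i l (block_perp pi eta) (block_avg pi eta) = 0.
Proof.
move=> iE lE he; have hp := tuple_L2_block_perp he.
have key i' l' j j' : j \in edge_seq ->
    \int[P]_x (edge_coef i' l' x * on_edge (block_avg pi eta) j' x *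
      on_edge (block_perp pi eta) j x) = 0.
  move=> jE; apply: (integral_block_constant_eq0 pi_gt0 pi_sum (edge_seq_neq jE)).
  - apply: bounded_measurableM; first exact: bounded_measurable_edge_coef.
    by apply: bounded_measurable_on_edge; exact: tuple_bounded_block_avg.
  - apply: block_constantM; first exact: block_constant_edge_coef.
    exact: (block_constant_comp pi_gt0 id).
  - exact: Lfun2_integrable.
  - move=> a b; apply: integral_cells_block_perp => //.
    exact: Lfun2_integrable (he _).
split; rewrite /edge_form.
  by under eq_Rintegral do rewrite mulrA; exact: key.
rewrite -(key i l i l iE); apply: eq_Rintegral => x _.
by rewrite -mulrA; congr (_ * _); rewrite mulrC.
Qed.

(** Differentiation under the integral, applied once with weight 1 and once
    more to each of the resulting terms. *)
Lemma graph_form_derive zeta : tuple_bounded zeta -> exists dL : R -> R,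
  (forall e : R, is_derive e (1 : R)
     (fun t : R => graph_density F (fun k z => V k z + t * zeta k z) g) (dL e)) /\
  is_derive (0 : R) (1 : R) dL (graph_form zeta zeta).
Proof.
move=> bz.
have us : uniq edge_seq by exact: enum_uniq.
have bv j := bounded_measurable_on_edge j tuple_bounded_step.
have bw j := bounded_measurable_on_edge j bz.
pose v := on_edge V; pose w := on_edge zeta.
pose gs j := g j.1.
have gsa j : real_analytic (gs j) by exact: ga.
have b1 : bounded_measurable (fun _ : q.-tuple mR => 1 : R).
  exact: bounded_measurable_cst.
pose LI := line_integral P edge_seq v w.
have LE t : graph_density F (fun k z => V k z + t * zeta k z) g =
    LI gs (fun=> 1) t.
  rewrite graph_densityE /LI /line_integral; apply: eq_Rintegral => x _.
  by rewrite /line_integrand mul1r.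
exists (fun e => \sum_(i <- edge_seq) LI (derive_at gs i) (fun x => 1 * w i x) e).
split=> [e|].
  under eq_fun do rewrite LE.
  exact: is_derive_line_integral.
have h i : is_derive (0 : R) (1 : R) (LI (derive_at gs i) (fun x => 1 * w i x))
    (\sum_(l <- edge_seq) edge_form i l zeta zeta).
  have ai := real_analytic_derive_at i gsa.
  have bi : bounded_measurable (fun x => 1 * w i x) by exact: bounded_measurableM.
  apply: is_derive_eq (is_derive_line_integral P us bv bw 0 ai bi) _.
  apply: eq_bigr => l _; apply: eq_Rintegral => x _.
  rewrite /line_integrand mul1r mulrC; congr (_ * _).
  by apply: eq_bigr => j _; rewrite mul0r addr0.
rewrite /graph_form; move: h.
set dd := fun i => \sum_(l <- edge_seq) edge_form i l zeta zeta => h.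
rewrite -/(\sum_(i <- edge_seq) dd i); elim: edge_seq => [|i s IH].
  under eq_fun do rewrite big_nil.
  by rewrite big_nil; exact: is_derive_cst.
under eq_fun do rewrite big_cons.
by rewrite big_cons; exact: (is_deriveD (h i) IH).
Qed.

Lemma graph_density_second_variation_form :
  second_variation_form pi V (fun W => graph_density F W g) graph_form.
Proof.
split.
- exact: graph_form_derive.
- move=> eta zeta xi he hz hx; rewrite /graph_form -big_split/=.
  rewrite !big_seq; apply: eq_bigr => i iE; rewrite -big_split/=.
  by rewrite !big_seq; apply: eq_bigr => l lE; exact: edge_form_addl.
- move=> eta zeta xi he hz hx; rewrite /graph_form -big_split/=.
  rewrite !big_seq; apply: eq_bigr => i iE; rewrite -big_split/=.
  by rewrite !big_seq; apply: eq_bigr => l lE; exact: edge_form_addr.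
- have h i l : exists C, 0 <= C /\ forall eta zeta, i \in edge_seq -> l \in edge_seq ->
      tuple_L2 eta -> tuple_L2 zeta ->
      `|edge_form i l eta zeta| <= C * (tuple_norm eta * tuple_norm zeta).
    by have [C C0 hC] := edge_form_bound i l; exists C.
  have /choice[C hC] (il : J * J) := h il.1 il.2.
  exists (\sum_(i <- edge_seq) \sum_(l <- edge_seq) C (i, l)).
    by apply: sumr_ge0 => i _; apply: sumr_ge0 => l _; case: (hC (i, l)).
  move=> eta zeta he hz; rewrite /graph_form (le_trans (ler_norm_sum _ _ _))//.
  rewrite mulr_suml !big_seq ler_sum// => i iE.
  rewrite (le_trans (ler_norm_sum _ _ _))//.
  rewrite mulr_suml !big_seq ler_sum// => l lE.
  by have [_ hil] := hC (i, l); exact: hil.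
- move=> eta he; rewrite /graph_form; split.
    rewrite big_seq big1// => i iE; rewrite big_seq big1// => l lE.
    by have [] := edge_form_cross iE lE he.
  rewrite big_seq big1// => i iE; rewrite big_seq big1// => l lE.
  by have [] := edge_form_cross iE lE he.
Qed.

End graph_density_form.

(** * Extension from bounded to square integrable directions *)

Section truncation.
Context (R : realType) d (T : measurableType d) (P : probability T R).

Definition truncate (N : R) (f : T -> R) (x : T) : R :=
  if `|f x| <= N then f x else 0.

Lemma bounded_measurable_truncate N f : measurable_fun setT f ->
  bounded_measurable (truncate N f).
Proof.
move=> mf; split; last first.
  exists `|N| => x _; rewrite /truncate; case: ifP => [/le_trans|_].
    by apply; exact: ler_norm.
  by rewrite normr0.
apply: measurable_fun_ifT => //.
by apply: measurable_fun_ler => //; exact: measurableT_comp.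
Qed.

(** Dominated convergence: the squared error vanishes at each point as soon as
    [N] exceeds the modulus of [f] there, and is at most [f x ^+ 2]. *)
Lemma truncate_approx (f : T -> R) (e : R) : f \in Lfun P 2%:E -> 0 < e ->
  exists N, ('N[P]_2%:E[EFin \o (truncate N f \- f)%R] < e%:E)%E.
Proof.
move=> f2 e0; have mf := Lfun2_measurable f2.
pose h (n : nat) x := ((truncate n%:R f x - f x) ^+ 2)%:E.
have mh n : measurable_fun setT (h n).
  apply/measurable_EFinP; apply: measurable_funX; apply: measurable_funB => //.
  by have [] := bounded_measurable_truncate n%:R mf.
have hub n x : (`|h n x| <= (f x ^+ 2)%:E)%E.
  rewrite /h lee_fin ger0_norm ?sqr_ge0// /truncate; case: ifP => _.
    by rewrite subrr expr0n/= sqr_ge0.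
  by rewrite sub0r sqrrN.
have hcvg x : h n x @[n --> \oo] --> 0%E.
  apply: cvg_near_cst; near=> n; rewrite /h /truncate.
  case: ifPn; first by rewrite subrr expr0n.
  move=> /negP; case; near: n; exact: nbhs_infty_ger.
have [_ _] := dominated_convergence measurableT mh
  (measurable_cst (0%E : \bar R)) (aeW _ (fun x _ => hcvg x))
  (Lfun2_integrable_sqr f2) (aeW _ (fun x n _ => hub n x)).
rewrite integral0 => /fine_cvgP[hfin hlim].
have e20 : 0 < e ^+ 2 by rewrite exprn_gt0.
near \oo => n; exists n%:R.
have hn : (\int[P]_x h n x < (e ^+ 2)%:E)%E.
  rewrite -[ltLHS]fineK; last by near: n.
  by rewrite lte_fin; near: n; exact: (cvgr_lt _ hlim).
rewrite ltNge; apply/negP => eN; move: hn; rewrite ltNge => /negP; apply.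
have -> : (\int[P]_x h n x =
    'N[P]_2%:E[EFin \o (truncate n%:R f \- f)%R] `^ 2)%E.
  rewrite poweR_Lnorm//; apply: eq_integral => x _.
  by rewrite /h /= powR_mulrn// real_normK// num_real.
have -> : ((e ^+ 2)%:E = e%:E `^ 2)%E by rewrite poweR_EFin powR_mulrn// ltW.
rewrite gt0_ler_poweR//.
- by rewrite in_itv/= leey lee_fin ltW.
- by rewrite in_itv/= leey Lnorm_ge0.
Unshelve. all: by end_near. Qed.

End truncation.

Lemma ae_leb01sq_filter (R : realType) :
  Filter (nbhs (almost_everywhere (leb01sq R))).
Proof. exact: (ae_filter_ringOfSetsType (leb01sq R)). Qed.

Section completion.
Variables (R : realType) (r m : nat) (pi : 'I_m -> R).
Local Notation mR := (measurableTypeR R).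
Implicit Types (V eta zeta : kernels R r) (L : kernels R r -> R).

Lemma sym_L2_tuple_L2 eta : sym_L2 eta -> tuple_L2 eta.
Proof. by move=> h k; case: (h k). Qed.

Lemma sym_bounded_tuple_bounded zeta : sym_bounded zeta -> tuple_bounded zeta.
Proof.
by move=> [h [M zM]] k; split; [case: (h k)|exists M => z _; exact: zM].
Qed.

(** Truncating each component gives bounded tuples arbitrarily close to [eta];
    truncation preserves symmetry, which is why [eta] has to be symmetric. *)
Lemma L2_approx_proper eta : sym_L2 eta -> ProperFilter (L2_approx eta).
Proof.
move=> he; apply: filter_from_proper; first apply: filter_from_filter.
- by exists 1; exact: ltr01.
- move=> d1 d2 d10 d20; exists (Num.min d1 d2); first by rewrite /= lt_min d10.
  move=> zeta [bz h]; split; split=> // k; rewrite (lt_le_trans (h k))// lee_fin.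
    by rewrite ge_min lexx.
  by rewrite ge_min lexx orbT.
move=> d d0.
have /choice[N hN] k : exists N, ('N[leb01sq R]_2%:E
    [EFin \o (truncate N (eta k) \- eta k)%R] < d%:E)%E.
  by apply: truncate_approx => //; case: (he k).
exists (fun k => truncate (N k) (eta k)); split; last exact: hN.
split=> [k|].
  have [e2 es] := he k; split.
    by have [] := bounded_measurable_truncate (N k) (Lfun2_measurable e2).
  move: es; rewrite /symmetric_ae.
  by apply: (@filterS _ _ (ae_leb01sq_filter R)) => z ez; rewrite /truncate ez.
exists (\sum_(k < r) `|N k|) => k z; rewrite /truncate.
have Nk : `|N k| <= \sum_(k < r) `|N k|.
  by rewrite (bigD1 k)//= lerDl sumr_ge0.
case: ifP => [zN|_]; last by rewrite normr0 (le_trans _ Nk).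
by rewrite (le_trans zN)// (le_trans _ Nk)// ler_norm.
Qed.

Lemma derive1n2_is_derive (f df : R -> R) (l : R) :
  (forall e : R, is_derive e (1 : R) f (df e)) ->
  is_derive (0 : R) (1 : R) df l -> derive1n 2 f 0 = l.
Proof.
move=> hf hdf; rewrite /derive1n/=.
have -> : derive1 f = df.
  by apply/funext => e; rewrite derive1E; have hfe := hf e; rewrite derive_val.
by rewrite derive1E derive_val.
Qed.

Lemma second_var_boundedE V L B zeta : second_variation_form pi V L B ->
  tuple_bounded zeta -> second_var_bounded L V zeta = B zeta zeta.
Proof.
by move=> hB bz; have [dL [h k]] := svf_derive hB bz; exact: derive1n2_is_derive h k.
Qed.

(** With [D] the norm of [delta = zeta - eta] and [S] that of [eta], bilinearity
    gives the bound [C * (2 * S + D) * D] for the error made at [zeta], so the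
    limit defining the extension exists; it is unique since the filter is
    proper. *)
Lemma second_varE V L B eta : second_variation_form pi V L B -> sym_L2 eta ->
  second_var L V eta = B eta eta.
Proof.
move=> hB he; have PF := L2_approx_proper he.
have e2 := sym_L2_tuple_L2 he.
apply: cvg_lim => //; apply/cvgrPdist_lt => e e0.
have [C C0 bB] := svf_bound hB.
pose S := tuple_norm eta; have S0 : 0 <= S by exact: tuple_norm_ge0.
(* The last summand keeps [K] positive and the final estimate strict. *)
pose K := C * (2 * S + 1) + 1.
have K0 : 0 < K by rewrite ltr_wpDl// mulr_ge0// addr_ge0// mulr_ge0.
pose t := Num.min 1 (e / K).
have t0 : 0 < t by rewrite lt_min ltr01 divr_gt0.
have r0 : 0 < r%:R + 1 :> R by rewrite ltr_wpDl.
(* The norm of the tuple is a sum of [r] norms, each below [t / (r + 1)]. *)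
exists (t / (r%:R + 1)); first exact: divr_gt0.
move=> zeta [sz hz].
have bz := sym_bounded_tuple_bounded sz; have z2 := tuple_bounded_L2 bz.
rewrite (second_var_boundedE hB bz).
pose delta : kernels R r := fun k z => zeta k z - eta k z.
have d2 : tuple_L2 delta by move=> k; apply: Lfun2B; [exact: z2|exact: e2].
have -> : zeta = tuple_add eta delta.
  by apply/funext => k; apply/funext => z; rewrite /tuple_add/delta addrC subrK.
have ed2 : tuple_L2 (tuple_add eta delta) by exact: tuple_L2D.
rewrite (svf_addl hB e2 d2 ed2) (svf_addr hB e2 d2 e2) (svf_addr hB e2 d2 d2).
pose D := tuple_norm delta; have D0 : 0 <= D by exact: tuple_norm_ge0.
have Dt : D <= t.
  apply: (@le_trans _ _ (\sum_(k < r) (t / (r%:R + 1)))).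
    apply: ler_sum => k _; rewrite -lee_fin fineK; last exact: Lfun2_fin_num (d2 k).
    exact: ltW (hz k).
  rewrite sumr_const card_ord -[leLHS]mulr_natr -mulrA; apply: ler_piMr; first exact: ltW.
  by rewrite mulrC ler_pdivrMr// mul1r lerDl.
have t1 : t <= 1 by rewrite ge_min lexx.
have te : t * K <= e.
  by rewrite -ler_pdivlMr// ge_min lexx orbT.
rewrite (_ : B eta eta - _ =
  - (B eta delta + (B delta eta + B delta delta))); last by ring.
rewrite normrN.
apply: (@le_lt_trans _ _ (C * (S * D) + (C * (D * S) + C * (D * D)))).
  rewrite (le_trans (ler_normD _ _))// lerD ?bB//.
  by rewrite (le_trans (ler_normD _ _))// lerD ?bB.
apply: (@le_lt_trans _ _ (C * (2 * S + 1) * t)).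
  have -> : C * (S * D) + (C * (D * S) + C * (D * D)) = C * (2 * S + D) * D by ring.
  rewrite ler_pM ?mulr_ge0 ?addr_ge0 ?mulr_ge0//.
  by rewrite ler_wpM2l// lerD2l (le_trans Dt).
apply: lt_le_trans te; rewrite mulrC ltr_pM2l// /K ltrDl//.
Qed.

End completion.

(** * Symmetry of block averages *)

Section block_symmetry.
Variables (R : realType) (r m : nat) (pi : 'I_m -> R).
Local Notation mR := (measurableTypeR R).

Definition swap (z : mR * mR) : mR * mR := (z.2, z.1).

Lemma measurable_swap : measurable_fun setT swap.
Proof. by apply: measurable_fun_pair; [exact: measurable_snd|exact: measurable_fst]. Qed.

(** Both sides are the integral over the two-dimensional cube of [f] read at
    its coordinates in reverse order. *)
Lemma ge0_integral_leb01sq_swap (f : mR * mR -> \bar R) :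
  measurable_fun setT f -> (forall z, 0 <= f z)%E ->
  (\int[leb01sq R]_z f (swap z) = \int[leb01sq R]_z f z)%E.
Proof.
move=> mf f0.
have n01 : (ord0 : 'I_2) != ord_max by [].
have n10 : (ord_max : 'I_2) != ord0 by [].
rewrite -[RHS](ge0_integral_two_coords n10)//.
rewrite -[LHS](ge0_integral_two_coords n01 (f := f \o swap))//.
  by apply: measurableT_comp => //; exact: measurable_swap.
by move=> z; exact: f0.
Qed.

Lemma integral_leb01sq_swap (f : mR * mR -> R) : measurable_fun setT f ->
  \int[leb01sq R]_z f (swap z) = \int[leb01sq R]_z f z.
Proof.
move=> mf; have mF : measurable_fun setT (EFin \o f) by exact/measurable_EFinP.
congr fine; rewrite -[LHS]/(\int[_]_x ((EFin \o f) \o swap) x)%E.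
rewrite -[RHS]/(\int[_]_x (EFin \o f) x)%E [LHS]integralE [RHS]integralE.
under eq_integral do rewrite funepos_comp/=.
under [X in (_ - X)%E]eq_integral do rewrite funeneg_comp/=.
rewrite !ge0_integral_leb01sq_swap//.
- exact: measurable_funeneg.
- exact: measurable_funepos.
Qed.

Lemma integral_cells_sym (eta : kernels R r) k i j : sym_L2 eta ->
  \int[leb01sq R]_(z in cell pi i `*` cell pi j) eta k z =
  \int[leb01sq R]_(z in cell pi j `*` cell pi i) eta k z.
Proof.
move=> he; have [e2 es] := he k; have me := Lfun2_measurable e2.
have mc i' j' : measurable (cell pi i' `*` cell pi j' : set (mR * mR)).
  by apply: measurableX; exact: measurable_cell.
have mr i' j' : measurable_fun setT (eta k \_ (cell pi i' `*` cell pi j')).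
  by apply/(measurable_restrictT _ (mc i' j')); exact: measurable_funTS.
rewrite Rintegral_mkcond [RHS]Rintegral_mkcond -(integral_leb01sq_swap (mr i j)).
congr fine; apply: ae_eq_integral => //.
- by apply/measurable_EFinP; exact: (measurableT_comp (mr i j) measurable_swap).
- by apply/measurable_EFinP; exact: (mr j i).
move: es; rewrite /symmetric_ae.
apply: (@filterS _ _ (ae_leb01sq_filter R)) => -[x y] /= exy _; rewrite !patchE /swap/=.
have -> : ((y, x) \in cell pi i `*` cell pi j) = ((x, y) \in cell pi j `*` cell pi i).
  by apply/idP/idP; rewrite !inE => -[]; split.
by case: ifP => // _; rewrite exy.
Qed.

Lemma sym_L2_block_avg (eta : kernels R r) : sym_L2 eta -> sym_L2 (block_avg pi eta).
Proof.
move=> he k; split; first exact: tuple_bounded_L2 (tuple_bounded_block_avg pi eta) k.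
apply: aeW => z; rewrite block_avgE; apply: block_fun_swap => i j.
by rewrite mulrC [in RHS]mulrC (integral_cells_sym _ _ _ he) (mulrC (pi i)).
Qed.

Lemma sym_L2_block_perp (eta : kernels R r) : sym_L2 eta -> sym_L2 (block_perp pi eta).
Proof.
move=> he k; have [e2 es] := he k; have [b2 bs] := sym_L2_block_avg he k.
split; first exact: Lfun2B.
move: es bs; rewrite /symmetric_ae.
apply: (@filterS2 _ _ (ae_leb01sq_filter R)) => z ez bz.
by rewrite /block_perp -ez -bz.
Qed.

End block_symmetry.

(** * The Lagrangian and the orthogonal decomposition *)

Section edge_graph.
Variables (R : realType) (r : nat).

Definition single_edge (k k' : 'I_r) : {set 'I_2 * 'I_2} :=
  if k' == k then [set (ord0, ord_max)]%SET else finset.set0.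

Fact single_edge_once k k' a b :
  (a, b) \in single_edge k k' -> (b, a) \notin single_edge k k'.
Proof.
rewrite /single_edge; case: ifP => _; rewrite !inE// => /eqP[-> ->].
by rewrite xpair_eqE.
Qed.

Definition edge_graph k : mgraph r := MGraph (@single_edge_once k).

(** This makes the objective [f_d] a sum of graph densities, so that it needs
    no separate analysis. *)
Lemma integral_edge_graph (f0 : R -> R) (W : kernels R r) k :
  continuous f0 -> tuple_bounded W ->
  graph_density (edge_graph k) W (fun=> f0) = \int[leb01sq R]_z f0 (W k z).
Proof.
move=> cf bW.
have n01 : (ord0 : 'I_2) != ord_max by [].
rewrite -(integral_two_coords n01 (f := fun z => f0 (W k z))); last first.
  exact: (bounded_measurable_comp cf (bW k)).1.
apply: eq_Rintegral => x _.
rewrite (bigD1 k)//= [X in _ * X]big1 ?mulr1 => [|k' k'k].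
  by rewrite /single_edge eqxx big_set1.
by rewrite /single_edge (negPf k'k) big_set0.
Qed.

End edge_graph.

Section lagrangian.
Variables (R : realType) (r n m : nat) (pi : 'I_m -> R).
Hypothesis pi_gt0 : forall i, 0 < pi i.
Hypothesis pi_sum : \sum_(i < m) pi i = 1.
Variables (Fs : 'I_n -> qgraph R r) (u : 'rV[R]_n) (h : 'I_n -> 'I_r -> R -> R).
Hypothesis ha : forall i k, real_analytic (h i k).
Variables (f0 : R -> R) (mu : 'rV[R]_n) (A : 'I_r -> 'M[R]_m).
Hypothesis f0a : real_analytic f0.
Local Notation V := (step A pi).

Lemma graph_density_form_exists F (g : 'I_r -> R -> R) :
  (forall k, real_analytic (g k)) ->
  exists B, second_variation_form pi V (fun W => graph_density F W g) B.
Proof.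
by move=> ga; exists (graph_form pi F g A); exact: graph_density_second_variation_form.
Qed.

Lemma density_form_exists i :
  exists B, second_variation_form pi V (fun W => density (Fs i) W (h i)) B.
Proof.
apply: second_variation_form_sum => -[c F].
have [B hB] := graph_density_form_exists F (ha i).
by exists (fun x y => c * B x y); exact: second_variation_formZ.
Qed.

Lemma f_d_form_exists : exists B, second_variation_form pi V (f_d f0) B.
Proof.
have [B hB] : exists B, second_variation_form pi V
    (fun W => \sum_(k < r) graph_density (edge_graph k) W (fun=> f0)) B.
  by apply: second_variation_form_sum => k; exact: graph_density_form_exists.
exists B; apply: second_variation_form_ext hB; first exact: tuple_bounded_step.
move=> W bW; apply: eq_bigr => k _; apply: integral_edge_graph => //.
exact: real_analytic_continuous.
Qed.

Lemma lagrangian_form_exists :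
  exists B, second_variation_form pi V (lagrangian f0 Fs u h mu) B.
Proof.
have [B1 h1] := f_d_form_exists.
have [B2 h2] : exists B, second_variation_form pi V
    (fun W => \sum_(i < n) mu 0 i * (density (Fs i) W (h i) + - u 0 i)) B.
  apply: second_variation_form_sum => i; have [B hB] := density_form_exists i.
  eexists; apply: second_variation_formZ; apply: second_variation_formD hB _.
  exact: second_variation_form_cst.
exists (fun x y => B1 x y + -1 * B2 x y).
have -> : lagrangian f0 Fs u h mu = fun W => f_d f0 W +
    -1 * \sum_(i < n) mu 0 i * (density (Fs i) W (h i) + - u 0 i).
  by apply/funext => W; rewrite mulN1r.
by apply: second_variation_formD h1 _; exact: second_variation_formZ.
Qed.

End lagrangian.

Lemma block_avg_perp (R : realType) (r m : nat) (pi : 'I_m -> R)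
    (eta : kernels R r) :
  tuple_add (block_avg pi eta) (block_perp pi eta) = eta.
Proof.
by apply/funext => k; apply/funext => z; rewrite /tuple_add /block_perp addrC subrK.
Qed.

(** Expand the form on the sum of the average and its complement; the two cross
    terms vanish. *)
Lemma second_var_pythagoras (R : realType) (r m : nat) (pi : 'I_m -> R)
    (V : kernels R r) L B (eta : kernels R r) :
  second_variation_form pi V L B -> sym_L2 eta ->
  second_var L V eta =
  second_var L V (block_avg pi eta) + second_var L V (block_perp pi eta).
Proof.
move=> hB he.
have ha := sym_L2_block_avg pi he; have hp := sym_L2_block_perp pi he.
have a2 := sym_L2_tuple_L2 ha; have p2 := sym_L2_tuple_L2 hp.
rewrite !(second_varE hB)// -{1 2}(block_avg_perp pi eta).
rewrite (svf_addl hB)//; last exact: tuple_L2D.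
have [ap pa] := svf_cross hB (sym_L2_tuple_L2 he).
by rewrite (svf_addr hB a2 p2 a2) (svf_addr hB a2 p2 p2) ap pa addr0 add0r.
Qed.

Theorem lemma5p7 (R : realType) (r n : nat) (hr : (0 < r)%N)
  (Fs : 'I_n -> qgraph R r) (u : 'rV[R]_n)
  (h : 'I_n -> 'I_r -> R -> R) (hh : forall i k, real_analytic (h i k))
  (f0 : R -> R) (hf0 : real_analytic f0)
  (m1 : nat) (hm1 : is_m1 Fs u h m1)
  (A : 'I_r -> 'M[R]_m1) (pi : 'I_m1 -> R)
  (hV : step_constraint Fs u h A pi) (hpi : forall i, 0 < pi i)
  (mu : 'rV[R]_n) (hcrit : step_critical (lagrangian f0 Fs u h mu) A pi)
  (eta : kernels R r) (heta : sym_L2 eta) :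
  second_var (lagrangian f0 Fs u h mu) (step A pi) eta =
    second_var (lagrangian f0 Fs u h mu) (step A pi) (block_avg pi eta) +
    second_var (lagrangian f0 Fs u h mu) (step A pi) (block_perp pi eta) /\
  second_var_bil (lagrangian f0 Fs u h mu) (step A pi)
    (block_avg pi eta) (block_perp pi eta) = 0.
Proof.
have [[_ _ pi1] _] := hV.
have [B hB] := lagrangian_form_exists hpi pi1 Fs u hh mu A hf0.
have pyth := second_var_pythagoras hB heta.
split=> //; rewrite /second_var_bil.
have -> : (fun k z => block_avg pi eta k z + block_perp pi eta k z) = eta.
  exact: block_avg_perp.
by rewrite pyth -addrA -opprD subrr mul0r.
Qed.
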